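(* Let $l>0$ and, for each $d$, $h=ld^{-1/2}$. Let $\widetilde K$ range over the class $\mathcal{I}$ of product couplings of the RWM kernels $K(X_t,\cdot),K(Y_t,\cdot)$ targeting $\pi=\mathcal{N}_d(0,I_d)$ with step size $h$. Then for all $(x,y,v)\in\mathcal{S}$, $$\lim_{d\to\infty}\sup_{\widetilde K\in\mathcal{I}}\mathbb{E}\Big[h^2Z_x^\top Z_yB_xB_y\ \Big|\ \tfrac{\lVert X_t\rVert^2}{d}=x,\ \tfrac{\lVert Y_t\rVert^2}{d}=y,\ \tfrac{X_t^\top Y_t}{d}=v\Big]=l^2\,\mathbb{E}\Big[1\wedge e^{-lx^{1/2}Z-l^2/2}\wedge e^{-ly^{1/2}Z-l^2/2}\Big],$$ where $Z\sim\mathcal{N}(0,1)$, and the right-hand side is attained (as the $d\to\infty$ limit of the same conditional expectation) by the GCRN coupling.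
   Context: RWM updates: $X_{t+1}=X_t+hZ_xB_x$, $Y_{t+1}=Y_t+hZ_yB_y$, with $B_x=\mathbb{1}\{U_x\le\exp(-hX_t^\top Z_x-h^2\lVert Z_x\rVert^2/2)\}$, $B_y=\mathbb{1}\{U_y\le\exp(-hY_t^\top Z_y-h^2\lVert Z_y\rVert^2/2)\}$, marginally $Z_x,Z_y\sim\mathcal{N}_d(0,I_d)$ and $U_x,U_y\sim\mathrm{Unif}(0,1)$, $U_x$ independent of $Z_x$, $U_y$ independent of $Z_y$. A Markovian coupling couples $(U_x,Z_x)$ and $(U_y,Z_y)$ conditionally on $(X_t,Y_t)$. The class $\mathcal{I}$ of product couplings consists of all such couplings in which the pair $(U_x,U_y)$ is independent of the pair $(Z_x,Z_y)$. The GCRN coupling sets $U_y=U_x$ and $Z_x=Z-(n_x^\top Z)n_x+Z_1n_x$, $Z_y=Z-(n_y^\top Z)n_y+Z_1n_y$ with $n_x=-X_t/\lVert X_t\rVert$, $n_y=-Y_t/\lVert Y_t\rVert$, $Z\sim\mathcal{N}_d(0,I_d)$, $Z_1\sim\mathcal{N}(0,1)$ independent. $\mathcal{S}=\{(x,y,v):x,y\ge0,|v|\le\sqrt{xy}\}$. *)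

(* Defs.v *)
From HB Require Import structures.
From mathcomp Require Import all_boot all_order all_algebra.
From mathcomp Require Import all_classical all_reals all_analysis.
Set Implicit Arguments. Unset Strict Implicit. Unset Printing Implicit Defensive.
Import Order.TTheory GRing.Theory Num.Theory.
Import numFieldNormedType.Exports.
Local Open Scope classical_set_scope.
Local Open Scope ring_scope.

Section rwm.
Context {R : realType}.

(** Vectors of R^d are represented as d-tuples (measurable via the product
    sigma-algebra generated by the coordinates).  *)
Definition vec (d : nat) (z : d.-tuple R) : 'I_d -> R := fun i => tnth z i.

Definition dotv (d : nat) (a b : 'I_d -> R) : R := \sum_(i < d) a i * b i.

(** Acceptance indicator B = 1{U <= exp(-h X^T Z - h^2 ||Z||^2 / 2)} of the
    RWM kernel targeting N_d(0, I_d), at current state X, proposal noise Z. *)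
Definition accept (d : nat) (h : R) (X Z : 'I_d -> R) (u : R) : R :=
  if u <= expR (- (h * dotv X Z) - h ^+ 2 * dotv Z Z / 2) then 1 else 0.

Definition cross_term (d : nat) (h : R) (X Y : 'I_d -> R)
  (ux : R) (zx : 'I_d -> R) (uy : R) (zy : 'I_d -> R) : R :=
  h ^+ 2 * dotv zx zy * accept h X zx ux * accept h Y zy uy.

Definition box (d : nat) (B : 'I_d -> set R) : set (d.-tuple R) :=
  [set z | forall i, B i (tnth z i)].

Definition unif01 := uniform_prob (@ltr01 R).

Definition gauss_box (d : nat) (B : 'I_d -> set R) : \bar R :=
  (\prod_(i < d) normal_prob (0:R) 1 (B i))%E.

(** Sample space of a Markovian coupling: ((U_x, U_y), (Z_x, Z_y)). *)
Definition Omega (d : nat) := ((R * R) * (d.-tuple R * d.-tuple R))%type.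

(** The class I of product couplings (as joint laws of (U_x,U_y,Z_x,Z_y)):
    (U_x, Z_x) ~ Unif(0,1) (x) N_d(0,I_d), (U_y, Z_y) ~ Unif(0,1) (x) N_d(0,I_d)
    (laws specified on measurable rectangles A x box, a generating pi-system),
    and (U_x, U_y) independent of (Z_x, Z_y). *)
Definition product_coupling (d : nat) (P : probability (Omega d) R) : Prop :=
  [/\ (forall (A : set R) (B : 'I_d -> set R), measurable A ->
        (forall i, measurable (B i)) ->
        P [set w | A w.1.1 /\ box B w.2.1] = (unif01 A * gauss_box B)%E),
      (forall (A : set R) (B : 'I_d -> set R), measurable A ->
        (forall i, measurable (B i)) ->
        P [set w | A w.1.2 /\ box B w.2.2] = (unif01 A * gauss_box B)%E) &
      (forall (A : set (R * R)) (B : set (d.-tuple R * d.-tuple R)),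
        measurable A -> measurable B ->
        P [set w | A w.1 /\ B w.2] =
        (P [set w | A w.1] * P [set w | B w.2])%E)].

Definition coupling_expect (d : nat) (h : R) (X Y : d.-tuple R)
  (P : probability (Omega d) R) : \bar R :=
  (\int[P]_w (cross_term h (vec X) (vec Y) w.1.1 (vec w.2.1) w.1.2 (vec w.2.2))%:E)%E.

Definition sup_I (d : nat) (h : R) (X Y : d.-tuple R) : \bar R :=
  ereal_sup [set e | exists P : probability (Omega d) R,
                       product_coupling P /\ e = coupling_expect h X Y P].

(** GCRN coupling.  Underlying randomness: (U, Z, Z_1) independent,
    U ~ Unif(0,1), Z ~ N_d(0,I_d), Z_1 ~ N(0,1). *)
Definition GOmega (d : nat) := (R * (d.-tuple R * R))%type.

Definition gcrn_law (d : nat) (Q : probability (GOmega d) R) : Prop :=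
  forall (A : set R) (B : 'I_d -> set R) (C : set R), measurable A ->
    (forall i, measurable (B i)) -> measurable C ->
    Q [set w | [/\ A w.1, box B w.2.1 & C w.2.2]] =
    (unif01 A * gauss_box B * normal_prob 0 1 C)%E.

(** n = - X / ||X||  (with the MathComp convention 0^-1 = 0, i.e. n = 0 if X = 0) *)
Definition gcrn_dir (d : nat) (X : 'I_d -> R) : 'I_d -> R :=
  fun i => - X i / Num.sqrt (dotv X X).

Definition gcrn_noise (d : nat) (n Z : 'I_d -> R) (z1 : R) : 'I_d -> R :=
  fun i => Z i - dotv n Z * n i + z1 * n i.

Definition gcrn_expect (d : nat) (h : R) (X Y : d.-tuple R)
  (Q : probability (GOmega d) R) : \bar R :=
  (\int[Q]_w (cross_term h (vec X) (vec Y)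
       w.1 (gcrn_noise (gcrn_dir (vec X)) (vec w.2.1) w.2.2)
       w.1 (gcrn_noise (gcrn_dir (vec Y)) (vec w.2.1) w.2.2))%:E)%E.

Definition limit_value (l x y : R) : \bar R :=
  ((l ^+ 2)%:E * \int[normal_prob 0 1]_z
     (Num.min 1 (Num.min (expR (- (l * Num.sqrt x * z) - l ^+ 2 / 2))
                         (expR (- (l * Num.sqrt y * z) - l ^+ 2 / 2))))%:E)%E.

Definition S_set : set (R * R * R) :=
  [set t | 0 <= t.1.1 /\ 0 <= t.1.2 /\ `|t.2| <= Num.sqrt (t.1.1 * t.1.2)].

End rwm.

(* Main.v *)
(** Upper bound. For any product coupling,
    [h^2 Zx.Zy Bx By <= l^2 Bx By + (h^2/2) (| |Zx|^2 - d | + | |Zy|^2 - d |)],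
    and the norm deviations are O(sqrt d) in mean, so only P(Bx = By = 1) matters.
    Conditioning on (Zx, Zy), independence of (Ux, Uy) bounds it by the mean of
    1 /\ exp(..) /\ exp(..) (written [min1]), where |Z|^2 may be replaced by d
    since u |-> 1 /\ e^u is 1-Lipschitz. What remains is an optimal transport
    problem between the two standard normals X.Zx/|X| and Y.Zy/|Y|; as both
    exponentials are monotone in the same direction, explicit dual potentials
    [min1_dual] show that the comonotone coupling is optimal.

    Lower bound. Take Ux = Uy and let Zy be the image of Zx under the Householder
    reflection mapping X/|X| to Y/|Y|: the two projections agree and Zx.Zy
    differs from |Zx|^2 by a rank-one term. GCRN is treated by the same estimate
    [shared_uniform_bounds]. All errors are O(1/sqrt d).

    Invariance of the Gaussian law under Householder reflections is reduced to
    planar reflections, hence to shears of Lebesgue measure. *)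
Require Import Defs.
From HB Require Import structures.
From mathcomp Require Import all_boot all_order all_algebra.
From mathcomp Require Import all_classical all_reals all_analysis.
From mathcomp Require Import measurable_realfun ring lra.
Import Order.TTheory GRing.Theory Num.Theory.
Import numFieldNormedType.Exports.
Local Open Scope classical_set_scope.
Local Open Scope ring_scope.

Set Implicit Arguments.
Unset Strict Implicit.
Unset Printing Implicit Defensive.

(** * Measures and their images *)

(** The states vary with [d] and the supremum ranges over all product couplings, so every estimate
    is proved at fixed [d > 0], with a deviation constant that depends on neither the dimension nor
    the coupling; the limit is then a squeeze. The cost [1 /\ exp(..) /\ exp(..)] is supermodular in
    the two projections, which is why the comonotone coupling wins. Dual potentials turn this into
    an inequality that sees only the marginals, so an arbitrary coupling needs no further
    description. Gaussian vectors and couplings are specified only on boxes and rectangles.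
    Statements about general events therefore go through uniqueness of measures on pi-systems, and
    Gaussian invariance can be checked directly only for maps that touch one or two coordinates.
    [law] records that a measurable map carries one set function to another. The scalar product of
    the proposals has no sign, so integrability must be established before signed integrals are
    transported or split. A state may be zero; unit vectors [p] and [q] with [V.Z = |V| p.Z] then
    stand in for the normalized states. *)

Definition law (R : realType) d1 d2 (T1 : measurableType d1)
    (T2 : measurableType d2) (mu : set T1 -> \bar R) (f : T1 -> T2)
    (nu : set T2 -> \bar R) :=
  measurable_fun setT f /\ forall A, measurable A -> mu (f @^-1` A) = nu A.

Section law.
Context {R : realType}.

Lemma law_comp d1 d2 d3 (T1 : measurableType d1) (T2 : measurableType d2)
    (T3 : measurableType d3) (m1 : set T1 -> \bar R) (m2 : set T2 -> \bar R)
    (m3 : set T3 -> \bar R) f g :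
  law m1 f m2 -> law m2 g m3 -> law m1 (g \o f) m3.
Proof.
move=> [mf f12] [mg g23]; split; first exact: measurableT_comp.
move=> A mA; rewrite comp_preimage f12 ?g23// -[X in measurable X]setTI.
exact: mg.
Qed.

Lemma integral_law d1 d2 (T1 : measurableType d1) (T2 : measurableType d2)
    (mu : {measure set T1 -> \bar R}) (nu : {measure set T2 -> \bar R})
    (f : T1 -> T2) (g : T2 -> \bar R) :
  law mu f nu -> measurable_fun setT g -> (forall y, 0 <= g y)%E ->
  (\int[mu]_x g (f x) = \int[nu]_y g y)%E.
Proof.
move=> [mf fmu] mg g0.
transitivity (\int[pushforward mu f]_y g y)%E.
  by rewrite ge0_integral_pushforward.
by apply: eq_measure_integral => A mA _; exact: fmu.
Qed.

(** Measurable rectangles form a pi-system generating the product sigma-algebra, and the total mass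
    is finite. *)
Lemma rect_unique d1 d2 (T1 : measurableType d1) (T2 : measurableType d2)
    (m1 m2 : {measure set (T1 * T2) -> \bar R}) :
  (m1 setT < +oo)%E ->
  (forall A B, measurable A -> measurable B -> m1 (A `*` B) = m2 (A `*` B)) ->
  forall X, measurable X -> m1 X = m2 X.
Proof.
move=> m1oo m12 X mX.
pose C : set (set (T1 * T2)) :=
  [set C | exists A, measurable A /\ exists B, measurable B /\ C = A `*` B].
apply: (measure_unique C (fun=> setT)) => //.
- rewrite measurable_prod_measurableType //; congr (<<s _ >>).
  rewrite predeqE => D; split => [[A mA [B mB <-]]|[A [mA [B [mB ->]]]]].
    by exists A; split => //; exists B.
  by exists A => //; exists B.
- move=> /= _ _ [X1 [mX1 [X2 [mX2 ->]]]] [Y1 [mY1 [Y2 [mY2 ->]]]].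
  rewrite -setXI; exists (X1 `&` Y1); split; first exact: measurableI.
  by exists (X2 `&` Y2); split => //; exact: measurableI.
- by move=> _; exists setT; split => //; exists setT; split => //; rewrite setXTT.
- by rewrite bigcup_const.
- by move=> A [A1 [mA1 [A2 [mA2 ->]]]]; rewrite m12.
Qed.

(** The product measure integrates the [m2]-measure of the slices, and on the slice over [x] the map
    acts as [f x], which preserves [m2]. *)
Lemma law_skew d1 d2 (T1 : measurableType d1) (T2 : measurableType d2)
    (m1 : {measure set T1 -> \bar R})
    (m2 : {sigma_finite_measure set T2 -> \bar R}) (f : T1 -> T2 -> T2) :
  measurable_fun setT (fun z : T1 * T2 => f z.1 z.2) ->
  (forall x, law m2 (f x) m2) ->
  law (m1 \x m2)%E (fun z => (z.1, f z.1 z.2)) (m1 \x m2)%E.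
Proof.
move=> mf fm2; split; first exact: measurable_fun_pair.
move=> A mA; rewrite /product_measure1; apply: eq_integral => x _ /=.
have [_ fx] := fm2 x; rewrite -[RHS]fx. 
  by congr (m2 _); apply/seteqP; split => y; rewrite /xsection/= !inE.
exact: measurable_xsection.
Qed.

Lemma law_swap d1 d2 (T1 : measurableType d1) (T2 : measurableType d2)
    (m1 : {sigma_finite_measure set T1 -> \bar R})
    (m2 : {sigma_finite_measure set T2 -> \bar R}) :
  law (m1 \x m2)%E (fun z => (z.2, z.1)) (m2 \x m1)%E.
Proof.
have msw : measurable_fun [set: T1 * T2] (fun z => (z.2, z.1)).
  exact: measurable_fun_pair.
split=> // A mA; apply/esym.
apply: (product_measure_unique (m' := pushforward (m1 \x m2)%E (fun z => (z.2, z.1)))) => //.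
move=> B C mB mC; transitivity ((m1 \x m2)%E (C `*` B)).
  by congr ((m1 \x m2)%E _); apply/seteqP; split => -[a b] [].
by rewrite product_measure1E// muleC.
Qed.

End law.

(* The library builds its measures on [measurableTypeR R], whose display differs
   from that of the canonical structure of [R]; [onR] moves them to the latter. *)
Definition onR (R : realType) (m : set (measurableTypeR R) -> \bar R) :
  set R -> \bar R := m.

Section onR.
Context {R : realType}.

Section measure.
Variable m : {measure set (measurableTypeR R) -> \bar R}.
Let onR0 : onR m set0 = 0%E. Proof. exact: measure0. Qed.
Let onR_ge0 A : (0 <= onR m A)%E. Proof. exact: measure_ge0. Qed.
Let onR_sigma_additive : semi_sigma_additive (onR m).
Proof.
move=> F mF tF mUF.
exact: (@measure_semi_sigma_additive _ _ _ m F mF tF mUF).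
Qed.
HB.instance Definition _ := isMeasure.Build default_measure_display R R
  (onR m) onR0 onR_ge0 onR_sigma_additive.

Lemma law_onR : law m (id : measurableTypeR R -> R) (onR m).
Proof. by split=> [_ A mA|//]; rewrite setTI. Qed.

Lemma integral_onR (f : R -> \bar R) : measurable_fun setT f ->
  (forall x, 0 <= f x)%E -> (\int[onR m]_x f x = \int[m]_x f x)%E.
Proof. by move=> mf f0; rewrite -(integral_law law_onR). Qed.
End measure.

Section sigma_finite.
Variable m : {sigma_finite_measure set (measurableTypeR R) -> \bar R}.
Let onR_sigma_finite : sigma_finite setT (onR m).
Proof. exact: (@sigma_finiteT _ _ _ m). Qed.
HB.instance Definition _ := Measure_isSigmaFinite.Build
  default_measure_display R R (onR m) onR_sigma_finite.
End sigma_finite.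

Section probability.
Variable m : probability (measurableTypeR R) R.
Let onR_setT : onR m setT = 1%E. Proof. exact: probability_setT. Qed.
HB.instance Definition _ := Measure_isProbability.Build
  default_measure_display R R (onR m) onR_setT.
End probability.

End onR.

Definition leb (R : realType) : {sigma_finite_measure set R -> \bar R} :=
  onR (@lebesgue_measure R).

Definition gauss (R : realType) : probability R R := onR (@normal_prob R 0 1).

(** * Invariance of planar Lebesgue measure under shears and reflections *)

Section lebesgue.
Context {R : realType}.
Local Notation mu := (leb R).

Lemma law_translation (c : R) : law mu (fun y => y + c) mu.
Proof.
have mf : measurable_fun [set: R] (fun y => y + c) by exact: measurable_funD.
split=> // A mA; apply/esym.
apply: (@lebesgue_measure_unique R (pushforward lebesgue_measure ((fun y => y + c) : measurableTypeR R -> measurableTypeR R))) => // _ [[a b] _ <-].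
transitivity (lebesgue_measure `](a - c), (b - c)]%classic); last first.
  by congr (lebesgue_measure _); apply/seteqP; split => y; rewrite /= !in_itv/= ltrBlDr lerBrDr.
transitivity (lebesgue_measure `]a, b]%classic) => //.
rewrite [LHS]lebesgue_measure_itv [RHS]lebesgue_measure_itv/= !lte_fin ltrD2r.
by case: ifP => // _; rewrite -!EFinD; congr (_%:E); ring.
Qed.

Lemma law_opp : law mu -%R mu.
Proof.
split; first exact: measurable_funN.
by move=> A mA; exact: lebesgue_measureN.
Qed.

Let mu2 := (mu \x mu)%E.

Lemma law_shear2 (t : R) : law mu2 (fun z => (z.1, z.2 + t * z.1)) mu2.
Proof.
apply: (@law_skew R _ _ _ _ mu mu (fun x y => y + t * x)) => [|x]; last exact: law_translation.
by apply: measurable_funD => //; exact: measurable_funM.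
Qed.

Lemma law_shear1 (t : R) : law mu2 (fun z => (z.1 + t * z.2, z.2)) mu2.
Proof.
have := law_comp (law_swap mu mu) (law_comp (law_shear2 t) (law_swap mu mu)).
by congr law; apply/funext => -[].
Qed.

Lemma law_flip2 : law mu2 (fun z => (z.1, - z.2)) mu2.
Proof.
apply: (@law_skew R _ _ _ _ mu mu (fun _ : R => -%R)) => [|x]; last exact: law_opp.
exact: measurable_funN.
Qed.

(* Up to a sign flip of the second coordinate the reflection is a rotation,
   and a rotation by an angle other than pi is a product of three shears. *)
Lemma law_reflection2 (c s : R) : c ^+ 2 + s ^+ 2 = 1 -> s != 0 ->
  law mu2 (fun z => (c * z.1 + s * z.2, s * z.1 - c * z.2)) mu2.
Proof.
move=> cs1 s0.
have c1 : 1 + c != 0.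
  apply: contra_neq s0 => /eqP; rewrite addrC addr_eq0 => /eqP cN1.
  by apply/eqP; rewrite -sqrf_eq0; move: cs1; rewrite cN1 => ?; apply/eqP; lra.
(* For [c = cos theta] and [s = sin theta] this is [- tan (theta / 2)], the coefficient of the two
   outer shears in the factorization of the rotation. *)
pose t := - s / (1 + c).
have := law_comp law_flip2 (law_comp (law_shear1 t)
  (law_comp (law_shear2 s) (law_shear1 t))).
congr law; apply/funext => -[a b] /=.
have st : s * t = c - 1.
  by rewrite /t; apply: (mulIf c1); rewrite -!mulrA mulVf// mulr1; lra.
have tc : t * (1 + c) = - s by rewrite /t mulrVK// unitfE.
congr pair.
  transitivity (a * (1 + s * t) - b * (t * (1 + (1 + s * t)))); first ring.
  by rewrite st (_ : 1 + (c - 1) = c); [rewrite tc; ring|ring].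
transitivity (s * a - b * (1 + s * t)); first ring.
by rewrite st; ring.
Qed.

End lebesgue.

(** * Integration against a measure with a density *)

Section density.
Context {R : realType} d (T : measurableType d).
Variables (mu nu : {measure set T -> \bar R}) (p : T -> R).
Hypotheses (p0 : forall x, 0 <= p x) (mp : measurable_fun setT p)
  (nuE : forall A, measurable A -> nu A = (\int[mu]_(x in A) (p x)%:E)%E).
Import HBNNSimple.
Local Open Scope ereal_scope.

(** By linearity only indicators remain, and for them the identity is the hypothesis [nuE]. Negative
    levels have empty preimage. *)
Let integral_density_nnsfun (f : {nnsfun T >-> R}) :
  \int[nu]_x (f x)%:E = \int[mu]_x ((f x)%:E * (p x)%:E).
Proof.
have mpE : measurable_fun setT (EFin \o p) by exact/measurable_EFinP.
under eq_integral do rewrite fimfunE -fsumEFin//.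
rewrite ge0_integral_fsum//; last 2 first.
  - by move=> r; exact/measurable_EFinP/measurableT_comp.
  - by move=> n x _; rewrite EFinM nnfun_muleindic_ge0.
under [RHS]eq_integral.
  move=> x xD; rewrite fimfunE -fsumEFin// ge0_mule_fsuml; last first.
    by move=> r; rewrite EFinM nnfun_muleindic_ge0.
  over.
rewrite [RHS]ge0_integral_fsum//; last 2 first.
  - move=> r; apply: emeasurable_funM => //.
    by apply/measurable_EFinP; exact/measurableT_comp.
  - by move=> n x _; rewrite mule_ge0 ?lee_fin// -lee_fin EFinM nnfun_muleindic_ge0.
apply: eq_fsbigr => r _; rewrite integralZl_indic_nnsfun//.
rewrite integral_indic// setIT nuE//.
have [r0|r0] := leP 0%R r; last first.
  rewrite preimage_nnfun0// integral_set0 mule0 integral0_eq// => x _.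
  by rewrite indic0 mulr0 mul0e.
rewrite -ge0_integralZl//; last 2 first.
  - exact: measurable_funTS.
  - by move=> x _; rewrite lee_fin.
rewrite integral_mkcond; apply: eq_integral => x _.
rewrite patchE indicE; case: (_ \in _) => /=; first by rewrite mulr1.
by rewrite mulr0 mul0e.
Qed.

(** Monotone convergence on both sides along the simple approximations of [f]; multiplying by
    [p >= 0] keeps them increasing. *)
Lemma ge0_integral_density (f : T -> \bar R) : measurable_fun setT f ->
  (forall x, 0 <= f x) -> \int[nu]_x f x = \int[mu]_x (f x * (p x)%:E).
Proof.
move=> mf f0.
have mpE : measurable_fun setT (EFin \o p) by exact/measurable_EFinP.
pose f_ := nnsfun_approx measurableT mf.
have f_f x : EFin \o f_^~ x @ \oo --> f x by exact: cvg_nnsfun_approx.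
transitivity (limn (fun n => \int[nu]_x (f_ n x)%:E)).
  rewrite -monotone_convergence//=.
  - by apply: eq_integral => x _; apply/esym/cvg_lim => //; exact: f_f.
  - by move=> n; exact/measurable_EFinP/measurable_funTS.
  - by move=> n ? _; rewrite lee_fin.
  - by move=> ? _ ? ? mn; rewrite lee_fin; exact/lefP/nd_nnsfun_approx.
under eq_fun do rewrite integral_density_nnsfun.
rewrite -monotone_convergence//=.
- apply: eq_integral => x _; apply/cvg_lim => //.
  by apply: cvgeZr => //; exact: f_f.
- move=> n; apply: emeasurable_funM => //.
  exact/measurable_EFinP/measurable_funTS.
- by move=> n x _; rewrite mule_ge0// lee_fin.
- move=> x _ a b ab; rewrite lee_wpmul2r ?lee_fin//.
  exact/lefP/nd_nnsfun_approx.
Qed.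

End density.

(** * Integrals of nonnegative real functions *)

Section ge0_real_integral.
Context {R : realType} d (T : measurableType d) (mu : {measure set T -> \bar R}).
Implicit Types f g : T -> R.

Lemma ge0_integral_EFinZ f k : measurable_fun setT f -> (forall x, 0 <= f x) ->
  0 <= k -> (\int[mu]_x (k * f x)%:E = k%:E * \int[mu]_x (f x)%:E)%E.
Proof.
move=> mf f0 k0; rewrite -ge0_integralZl//; first exact/measurable_EFinP.
by move=> x _; rewrite lee_fin.
Qed.

Lemma ge0_integral_EFinD f g : measurable_fun setT f -> (forall x, 0 <= f x) ->
  measurable_fun setT g -> (forall x, 0 <= g x) ->
  (\int[mu]_x (f x + g x)%:E = \int[mu]_x (f x)%:E + \int[mu]_x (g x)%:E)%E.
Proof.
move=> mf f0 mg g0; rewrite -ge0_integralD//.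
- by move=> x _; rewrite lee_fin.
- exact/measurable_EFinP.
- by move=> x _; rewrite lee_fin.
- exact/measurable_EFinP.
Qed.

Lemma ge0_le_integral_EFin f g : measurable_fun setT f -> (forall x, 0 <= f x) ->
  measurable_fun setT g -> (forall x, f x <= g x) ->
  (\int[mu]_x (f x)%:E <= \int[mu]_x (g x)%:E)%E.
Proof.
move=> mf f0 mg fg; apply: ge0_le_integral => //.
- by move=> x _; rewrite lee_fin.
- exact/measurable_EFinP.
- exact/measurable_EFinP.
- by move=> x _; rewrite lee_fin.
Qed.

(** Trades a finite extended integral for a real number, so that the final comparisons become real
    arithmetic. *)
Lemma ge0_integral_fineK f : (forall x, 0 <= f x) ->
  (\int[mu]_x (f x)%:E < +oo)%E ->
  exists2 r : R, 0 <= r & (\int[mu]_x (f x)%:E = r%:E)%E.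
Proof.
move=> f0 foo; have I0 : (0 <= \int[mu]_x (f x)%:E)%E.
  by apply: integral_ge0 => z _; rewrite lee_fin.
exists (fine (\int[mu]_x (f x)%:E)); first exact: fine_ge0.
by rewrite fineK// ge0_fin_numE.
Qed.

End ge0_real_integral.

Lemma integral_prob_cst (R : realType) d (T : measurableType d)
  (P : probability T R) (k : R) : (\int[P]_x k%:E = k%:E)%E.
Proof.
rewrite integral_cst// -[RHS]mule1; congr (_ * _)%E; exact: probability_setT.
Qed.

(** * The standard normal law on the line and the plane *)

Section gauss1.
Context {R : realType}.
Local Notation mu := (leb R).
Local Notation gamma := (gauss R).
Local Notation phi := (@normal_pdf R 0 1).

Lemma phiE (s x : R) : s != 0 ->
  normal_pdf 0 s x = normal_peak s * expR (- (x ^+ 2) / (s ^+ 2 *+ 2)).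
Proof. by move=> s0; rewrite normal_pdfE// /normal_fun subr0. Qed.

Lemma integral_gauss_pdf (s : R) : (\int[mu]_x (normal_pdf 0 s x)%:E = 1)%E.
Proof.
rewrite integral_onR ?integral_normal_pdf//.
  by apply/measurable_EFinP; exact: measurable_normal_pdf.
by move=> x; rewrite lee_fin normal_pdf_ge0.
Qed.

Lemma gaussE (A : set R) : measurable A ->
  (gamma A = \int[mu]_(x in A) (phi x)%:E)%E.
Proof.
move=> mA; rewrite integral_mkcond integral_onR.
- by rewrite -integral_mkcond.
- apply/(measurable_restrictT _ _).1 => //.
  by apply/measurable_EFinP/measurable_funTS; exact: measurable_normal_pdf.
- by move=> x; apply: erestrict_ge0 => y _; rewrite lee_fin normal_pdf_ge0.
Qed.

Lemma integral_gauss (f : R -> \bar R) : measurable_fun setT f ->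
  (forall x, 0 <= f x)%E ->
  (\int[gamma]_x f x = \int[mu]_x (f x * (phi x)%:E))%E.
Proof.
move=> mf f0; apply: (@ge0_integral_density R _ _ mu gamma) => //.
- exact: normal_pdf_ge0.
- exact: measurable_normal_pdf.
- exact: gaussE.
Qed.

(** The exponential factor tilts the standard density into [s] times the centred normal density of
    standard deviation [s], whose total mass is 1. All Gaussian moments below are drawn from this
    family. *)
Lemma integral_expR_sqr (s : R) : 0 < s ->
  (\int[gamma]_z (expR ((1 - (s ^+ 2)^-1) / 2 * z ^+ 2))%:E = s%:E)%E.
Proof.
move=> s0; have s0' := lt0r_neq0 s0.
rewrite integral_gauss//; last first.
  by apply/measurable_EFinP; apply: measurableT_comp => //; exact: measurable_funM.
under eq_integral => z _.
  rewrite -EFinM phiE ?oner_neq0// mulrCA -expRD.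
  rewrite (_ : _ * _ = s * normal_pdf 0 s z); last first.
    rewrite phiE// [RHS]mulrA; congr (_ * expR _); last by field.
    rewrite /normal_peak expr1n mul1r -mulrnAr sqrtrM ?sqr_ge0// sqrtr_sqr.
    by rewrite gtr0_norm// invfM mulrA divff// mul1r.
  over.
rewrite ge0_integral_EFinZ ?ltW//.
- by rewrite integral_gauss_pdf mule1.
- exact: measurable_normal_pdf.
- by move=> x; exact: normal_pdf_ge0.
Qed.



Let measurable_sqr : measurable_fun [set: R] (fun z : R => z ^+ 2).
Proof. exact: measurable_funX. Qed.

Let measurable_expR_sqr t :
  measurable_fun [set: R] (fun z : R => expR (t * z ^+ 2)).
Proof. by apply: measurableT_comp => //; exact: measurable_funM. Qed.

Let t2 : (1 - (2 ^+ 2)^-1) / 2 = 3 / 8 :> R. Proof. by field. Qed.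

Lemma integral_sqr_lty : (\int[gamma]_z (z ^+ 2)%:E < +oo)%E.
Proof.
(* The exponent [3/8] is the tilt with [s = 2]; [1 + u <= exp u] at [u = 3 z^2 / 8] gives the factor
   [8/3], rounded up to 3. *)
apply: (@le_lt_trans _ _ (\int[gamma]_z (3 * expR (3 / 8 * z ^+ 2))%:E)%E).
  apply: ge0_le_integral_EFin => //.
  - exact: sqr_ge0.
  - exact: measurable_funM.
  - move=> z; have := expR_ge1Dx (3 / 8 * z ^+ 2).
    have := sqr_ge0 z; lra.
rewrite ge0_integral_EFinZ//.
by rewrite -t2 integral_expR_sqr// -EFinM ltry.
Qed.

(* The exponential moments [E exp((1 - s^-2) z^2 / 2) = s] squeeze the second
   moment: as [1 + u <= exp u], it is at most [s^2] for [s > 1] and at least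
   [s^2] for [s < 1]. *)
Lemma integral_sqr : (\int[gamma]_z (z ^+ 2)%:E = 1)%E.
Proof.
have [m m0 mE] := ge0_integral_fineK (@sqr_ge0 R) integral_sqr_lty.
have ub (s : R) : 1 < s -> m <= s ^+ 2.
  move=> s1; have s0 : 0 < s by lra.
  have t0 : 0 <= (1 - (s ^+ 2)^-1) / 2.
    by rewrite divr_ge0// subr_ge0 invf_le1 ?exprn_gt0// exprn_ege1 ?ltW.
  have : (1 + ((1 - (s ^+ 2)^-1) / 2)%:E * m%:E <= s%:E)%E.
    rewrite -(integral_expR_sqr s0) -mE -ge0_integral_EFinZ//; last exact: sqr_ge0.
    rewrite -[1%E](integral_prob_cst gamma) -ge0_integral_EFinD//.
    - apply: ge0_le_integral_EFin => //.
      + by apply: measurable_funD => //; exact: measurable_funM.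
      + by move=> z; rewrite addr_ge0// mulr_ge0// sqr_ge0.
      + by move=> z; rewrite expR_ge1Dx.
    - exact: measurable_funM.
    - by move=> z; rewrite mulr_ge0// sqr_ge0.
  rewrite -EFinM -EFinD lee_fin => H.
  (* The inequality amounts to [m <= 2 s^2 / (s + 1)], which is at most [s^2] for [s > 1]. Scaling
     by [k = (s - 1) / s^2] leaves only polynomial arithmetic. *)
  have k0 : 0 < (s - 1) / s ^+ 2 by rewrite divr_gt0 ?exprn_gt0 ?subr_gt0.
  have kE : (s - 1) / s ^+ 2 * s ^+ 2 = s - 1 by field; rewrite gt_eqF.
  have sE : (1 - (s ^+ 2)^-1) / 2 = (s + 1) * ((s - 1) / s ^+ 2) / 2.
    by field; rewrite gt_eqF.
  rewrite -(@ler_pM2l _ ((s - 1) / s ^+ 2))// kE.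
  move: H; rewrite sE; set k := (s - 1) / s ^+ 2 in k0 kE * => H.
  have : 0 <= (s - 1) * (k * m) by apply: mulr_ge0; [lra|apply: mulr_ge0 => //; exact: ltW].
  lra.
have lb (s : R) : 0 < s -> s < 1 -> s ^+ 2 <= m.
  move=> s0 s1.
  have t0 : 0 <= ((s ^+ 2)^-1 - 1) / 2.
    by rewrite divr_ge0// subr_ge0 invf_ge1 ?exprn_gt0// exprn_ile1 ?ltW.
  have : (1 <= s%:E + (((s ^+ 2)^-1 - 1) / 2)%:E * m%:E)%E.
    rewrite -(integral_expR_sqr s0) -mE -ge0_integral_EFinZ//; last exact: sqr_ge0.
    rewrite -[leLHS](integral_prob_cst gamma) -ge0_integral_EFinD//.
    - apply: ge0_le_integral_EFin => //.
      + by apply: measurable_funD => //; exact: measurable_funM.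
      + move=> z; have := expR_ge1Dx ((1 - (s ^+ 2)^-1) / 2 * z ^+ 2); lra.
    - exact: measurable_funM.
    - by move=> z; rewrite mulr_ge0// sqr_ge0.
  rewrite -EFinM -EFinD lee_fin => H.
  have k0 : 0 < (1 - s) / s ^+ 2 by rewrite divr_gt0 ?exprn_gt0 ?subr_gt0.
  have kE : (1 - s) / s ^+ 2 * s ^+ 2 = 1 - s by field; rewrite gt_eqF.
  have sE : ((s ^+ 2)^-1 - 1) / 2 = (s + 1) * ((1 - s) / s ^+ 2) / 2.
    by field; rewrite gt_eqF.
  rewrite -(@ler_pM2l _ ((1 - s) / s ^+ 2))// kE.
  move: H; rewrite sE; set k := (1 - s) / s ^+ 2 in k0 kE * => H.
  have : 0 <= (1 - s) * (k * m) by apply: mulr_ge0; [lra|apply: mulr_ge0 => //; exact: ltW].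
  lra.
(* If [m] differed from 1, then [s^2 = (1 + m) / 2] would lie strictly between 1 and [m] and
   contradict [ub] or [lb]. *)
rewrite mE; congr (_%:E); apply/eqP; rewrite eq_le; apply/andP; split.
  rewrite leNgt; apply/negP => m1.
  have s1 : 1 < Num.sqrt ((1 + m) / 2) by rewrite -[ltLHS]sqrtr1 ltr_sqrt; lra.
  by have := ub _ s1; rewrite sqr_sqrtr; lra.
rewrite leNgt; apply/negP => m1.
have s0 : 0 < Num.sqrt ((1 + m) / 2) by rewrite sqrtr_gt0; lra.
have s1 : Num.sqrt ((1 + m) / 2) < 1 by rewrite -[ltRHS]sqrtr1 ltr_sqrt; lra.
by have := lb _ s0 s1; rewrite sqr_sqrtr; lra.
Qed.

Lemma integral_sqrB1_sqr_lty : (\int[gamma]_z ((z ^+ 2 - 1) ^+ 2)%:E < +oo)%E.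
Proof.
(* With [z^2 = 8 v / 3], the fourth-degree polynomial is quadratic in [v] and
   [exp v >= (1 + v / 2)^2]. The constant 58 dominates coefficient by coefficient and is not
   sharp. *)
apply: (@le_lt_trans _ _ (\int[gamma]_z (58 * expR (3 / 8 * z ^+ 2))%:E)%E).
  apply: ge0_le_integral_EFin => //.
  - by apply: measurable_funX; exact: measurable_funB.
  - by move=> z; exact: sqr_ge0.
  - exact: measurable_funM.
  - move=> z; set v := 3 / 8 * _.
    have vE : z ^+ 2 = 8 / 3 * v by rewrite /v; field.
    have v0 : 0 <= v by rewrite mulr_ge0 ?sqr_ge0//; lra.
    have -> : v = v / 2 + v / 2 by field.
    rewrite expRD -expr2.
    have : (1 + v / 2) ^+ 2 <= expR (v / 2) ^+ 2.
      by rewrite ler_sqr ?expR_ge1Dx ?nnegrE ?expR_ge0//; lra.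
    rewrite vE; nra.
rewrite ge0_integral_EFinZ//.
by rewrite -t2 integral_expR_sqr// -EFinM ltry.
Qed.

Lemma law_gauss_opp : law gamma -%R gamma.
Proof.
split; first exact: measurable_funN.
move=> A mA; have mNA : measurable ((-%R : R -> R) @^-1` A).
  by rewrite -[X in measurable X]setTI; exact: (measurable_funN (@measurable_id _ _ _)).
have indE (B : set R) : measurable B ->
    (gamma B = \int[mu]_x ((\1_B x)%:E * (phi x)%:E))%E.
  move=> mB; rewrite -integral_gauss//; last exact/measurable_EFinP.
  by rewrite integral_indic// setIT.
rewrite !indE//.
rewrite -[RHS](integral_law law_opp).
- apply: eq_integral => x _; rewrite !indicE; congr (_ * _)%E.
  by rewrite !phiE ?oner_neq0// sqrrN.
- apply/measurable_EFinP; apply: measurable_funM => //.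
  exact: measurable_normal_pdf.
- by move=> x; rewrite -EFinM lee_fin mulr_ge0// normal_pdf_ge0.
Qed.

Let mu2 := (mu \x mu)%E.
Let gamma2 := (gamma \x gamma)%E.

(** Tonelli applied to the two one-dimensional densities. Having a planar density lets invariance be
    inherited from Lebesgue measure. *)
Lemma gamma2E (A : set (R * R)) : measurable A ->
  (gamma2 A = \int[mu2]_z (\1_A z * (phi z.1 * phi z.2))%:E)%E.
Proof.
move=> mA; have mphi := @measurable_normal_pdf R 0 1.
have mf : measurable_fun [set: R * R] (fun z => (\1_A z * (phi z.1 * phi z.2))%:E).
  apply/measurable_EFinP; apply: measurable_funM; first exact: measurable_indic.
  by apply: measurable_funM; exact: measurableT_comp.
have f0 z : (0 <= (\1_A z * (phi z.1 * phi z.2))%:E)%E.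
  by rewrite lee_fin !mulr_ge0 ?normal_pdf_ge0.
rewrite /mu2 fubini_tonelli1// /gamma2 /product_measure1 integral_gauss//; last first.
  exact: (measurable_fun_xsection gamma mA).
apply: eq_integral => x _; rewrite /fubini_F/=.
rewrite gaussE; last exact: measurable_xsection.
rewrite integral_mkcond muleC -ge0_integralZl//; last 3 first.
  - apply/(measurable_restrictT _ _).1; first exact: measurable_xsection.
    by apply/measurable_EFinP; exact: measurable_funTS.
  - by move=> y _; apply: erestrict_ge0 => z _; rewrite lee_fin normal_pdf_ge0.
  - by rewrite lee_fin normal_pdf_ge0.
apply: eq_integral => y _; rewrite patchE indicE mem_xsection.
case: (_ \in A); first by rewrite mul1r EFinM.
by rewrite mul0r mule0.
Qed.

(** The reflection preserves planar Lebesgue measure and [z.1^2 + z.2^2], on which alone the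
    Gaussian density depends. *)
Lemma law_gauss_reflection2 (c s : R) : c ^+ 2 + s ^+ 2 = 1 -> s != 0 ->
  law gamma2 (fun z => (c * z.1 + s * z.2, s * z.1 - c * z.2)) gamma2.
Proof.
move=> cs1 s0; have L := law_reflection2 cs1 s0; have [mS _] := L.
split=> // A mA.
have mSA : measurable ((fun z : R * R => (c * z.1 + s * z.2, s * z.1 - c * z.2)) @^-1` A).
  by rewrite -[X in measurable X]setTI; exact: mS.
have mphi := @measurable_normal_pdf R 0 1.
rewrite !gamma2E// -[RHS](integral_law L).
- apply: eq_integral => -[a b] _ /=; congr (_%:E); rewrite !indicE; congr (_ * _).
  rewrite !phiE ?oner_neq0// mulrACA [RHS]mulrACA -!expRD; congr (_ * expR _).
  rewrite expr1n -!mulrDl; congr (_ / _); rewrite -!opprD; congr (- _).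
  rewrite -[LHS]mul1r -cs1; ring.
- apply/measurable_EFinP; apply: measurable_funM; first exact: measurable_indic.
  by apply: measurable_funM; exact: measurableT_comp.
- by move=> z; rewrite lee_fin !mulr_ge0 ?normal_pdf_ge0.
Qed.

End gauss1.

(** * Gaussian vectors *)

Section tuples.
Context {R : realType} (d : nat).
Implicit Types (B : 'I_d -> set R) (w p q : 'I_d -> R) (z : d.-tuple R).

Lemma measurable_box B : (forall i, measurable (B i)) -> measurable (box B).
Proof.
move=> mB; rewrite (_ : box B = \bigcap_(i in [set: 'I_d]) ((fun z => tnth z i) @^-1` B i)).
  apply: fin_bigcap_measurable => // i _; rewrite -[X in measurable X]setTI.
  exact: measurable_tnth.
by apply/seteqP; split=> [z Bz i _|z Bz i]; [exact: Bz|exact: (Bz i I)].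
Qed.

(** Boxes are stable under intersection and generate: a condition on one coordinate is a box whose
    other sides are full. *)
Lemma box_unique (m1 m2 : {measure set (d.-tuple R) -> \bar R}) :
  (m1 setT < +oo)%E ->
  (forall B, (forall i, measurable (B i)) -> m1 (box B) = m2 (box B)) ->
  forall A, measurable A -> m1 A = m2 A.
Proof.
move=> m1oo m12 A mA.
pose G : set (set (d.-tuple R)) :=
  [set C | exists B : 'I_d -> set R, (forall i, measurable (B i)) /\ C = box B].
apply: (measure_unique G (fun=> setT)) => //.
- apply/seteqP; split => [C|C].
    apply: smallest_sub; first exact: smallest_sigma_algebra.
    move=> D; rewrite -bigcup_seq/= => -[i _ [E mE <-]].
    apply: sub_sigma_algebra.
    exists (fun k => if k == i then E else setT); split.
      by move=> k; case: ifP.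
    apply/seteqP; split => [z [_ Ez] k|z Bz].
      by case: eqP => // ->.
    by split => //; have := Bz i; rewrite eqxx.
  apply: smallest_sub; first exact: sigma_algebra_measurable.
  by move=> _ [B [mB ->]]; exact: measurable_box.
- move=> _ _ [B1 [mB1 ->]] [B2 [mB2 ->]].
  exists (fun i => B1 i `&` B2 i); split; first by move=> i; exact: measurableI.
  apply/seteqP; split => [z [z1 z2] i|z z12]; first by split.
  by split => i; have [] := z12 i.
- by move=> _; exists (fun=> setT); split => //; apply/seteqP; split.
- by rewrite bigcup_const.
- by move=> _ [B [mB ->]]; exact: m12.
Qed.

Lemma measurable_fun_dotv d' (T : measurableType d') (f g : T -> 'I_d -> R) :
  (forall i, measurable_fun setT (f ^~ i)) ->
  (forall i, measurable_fun setT (g ^~ i)) ->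
  measurable_fun setT (fun x => dotv (f x) (g x)).
Proof.
by move=> mf mg; apply: measurable_sum => i; exact: measurable_funM.
Qed.

Lemma measurable_vec i : measurable_fun [set: d.-tuple R] (fun z => vec z i).
Proof. exact: measurable_tnth. Qed.

Definition gaussian (nu : set (d.-tuple R) -> \bar R) :=
  forall B, (forall i, measurable (B i)) -> nu (box B) = gauss_box B.

Section gaussian.
Variables (nu : probability (d.-tuple R) R) (nug : gaussian nu).

Lemma gaussian_law (f : d.-tuple R -> d.-tuple R) : measurable_fun setT f ->
  (forall B, (forall i, measurable (B i)) -> nu (f @^-1` box B) = gauss_box B) ->
  law nu f nu.
Proof.
move=> mf fB; split=> // A mA.
apply: (box_unique (m1 := pushforward nu f)) => //.
  exact: (le_lt_trans (probability_le1 nu measurableT) (ltry 1)).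
by move=> B mB; transitivity (gauss_box B); [exact: fB|apply/esym; exact: nug].
Qed.

Lemma gaussian_coord i : law nu (fun z => tnth z i) (gauss R).
Proof.
split; first exact: measurable_tnth.
move=> A mA.
have := nug (B := fun k => if k == i then A else setT).
rewrite /gauss_box (bigD1 i)//= eqxx [X in (_ * X)%E]big1; last first.
  by move=> k /negbTE ->; exact: (@probability_setT _ _ _ (gauss R)).
rewrite mule1 => nE; rewrite -[RHS]nE; last by move=> k; case: ifP.
congr (nu _); apply/seteqP; split => [z Az k|z /(_ i)]; last by rewrite eqxx.
by case: eqP => // ->.
Qed.

(** With the sides [B] fixed, both members are finite measures in [M]. They agree on rectangles,
    where the event is again a box. *)
Lemma gaussian_pair_indep i j B (M : set (R * R)) : i != j ->
  (forall k, measurable (B k)) -> measurable M ->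
  nu [set z | M (tnth z i, tnth z j) /\
              forall k, k != i -> k != j -> B k (tnth z k)] =
  ((gauss R \x gauss R) M * \prod_(k | (k != i) && (k != j)) gauss R (B k))%E.
Proof.
move=> ij mB mM.
(* Scaling a measure takes a nonnegative real, hence the passage through [fine]. *)
pose c := \prod_(k | (k != i) && (k != j)) fine (gauss R (B k)).
have c0 : 0 <= c by rewrite prodr_ge0// => k _; rewrite fine_ge0.
have cE : (\prod_(k | (k != i) && (k != j)) gauss R (B k) = c%:E)%E.
  rewrite /c -prodEFin; apply: eq_bigr => k _; rewrite fineK//.
  exact: fin_num_measure.
pose D := [set z : d.-tuple R | forall k, k != i -> k != j -> B k (tnth z k)].
have DE : D = box (fun k => if (k != i) && (k != j) then B k else setT).
  apply/seteqP; split => z Dz k; last by move=> ki kj; have := Dz k; rewrite ki kj.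
  by case: ifP => // /andP[]; exact: Dz.
have mD : measurable D.
  by rewrite DE; apply: measurable_box => k; case: ifP.
pose f z : R * R := (tnth z i, tnth z j).
have mf : measurable_fun [set: d.-tuple R] f.
  by apply: measurable_fun_pair; exact: measurable_tnth.
rewrite cE muleC.
rewrite -[RHS]/(mscale (NngNum c0) (gauss R \x gauss R)%E M).
rewrite -[LHS]/(pushforward (mrestr nu mD) f M).
apply: rect_unique => //.
  rewrite /pushforward/= /mrestr.
  have mDT : measurable (f @^-1` setT `&` D) by rewrite preimage_setT setTI.
  exact: (le_lt_trans (probability_le1 nu mDT) (ltry 1)).
move=> A1 A2 mA1 mA2.
transitivity (c%:E * (gauss R A1 * gauss R A2))%E; last first.
  by congr (_ * _)%E; apply/esym; exact: product_measure1E.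
rewrite /pushforward/= /mrestr.
pose B' k := if k == i then A1 else if k == j then A2 else B k.
transitivity (nu (box B')).
  congr (nu _); apply/seteqP; split => [z [[z1 z2] Dz] k|z Bz].
    rewrite /B'; have [->//|ki] := eqVneq k i; have [->//|kj] := eqVneq k j.
    exact: Dz.
  split; first split => /=.
  - by have := Bz i; rewrite /B' eqxx.
  - by have := Bz j; rewrite /B' eqxx eq_sym (negbTE ij).
  - by move=> k ki kj; have := Bz k; rewrite /B' (negbTE ki) (negbTE kj).
rewrite nug; last by move=> k; rewrite /B'; case: ifP => // _; case: ifP.
rewrite /gauss_box (bigD1 i)//= (bigD1 j)/=; last by rewrite eq_sym.
rewrite {1 2}/B' !eqxx eq_sym (negbTE ij) muleA muleC -cE; congr (_ * _)%E.
by apply: eq_bigr => k /andP[/negbTE ki /negbTE kj]; rewrite /B' ki kj.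
Qed.

Lemma gaussian_pair i j : i != j ->
  law nu (fun z => (tnth z i, tnth z j)) (gauss R \x gauss R)%E.
Proof.
move=> ij; split; first by apply: measurable_fun_pair; exact: measurable_tnth.
move=> M mM; have := gaussian_pair_indep (B := fun=> setT) ij _ mM.
rewrite big1 ?mule1 => [<-//|k _]; last exact: (@probability_setT _ _ _ (gauss R)).
by congr (nu _); apply/seteqP; split => z //= [].
Qed.

Definition plane_refl (i j : 'I_d) (c s : R) z : d.-tuple R :=
  [tuple if k == i then c * tnth z i + s * tnth z j
         else if k == j then s * tnth z i - c * tnth z j
         else tnth z k | k < d].

Lemma gaussian_plane_refl i j c s : i != j -> c ^+ 2 + s ^+ 2 = 1 -> s != 0 ->
  law nu (plane_refl i j c s) nu.
Proof.
move=> ij cs1 s0; have [mS gS] := law_gauss_reflection2 cs1 s0.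
apply: gaussian_law.
  apply/measurable_fun_tnthP => k.
  rewrite (_ : _ \o _ = fun z => if k == i then c * tnth z i + s * tnth z j
      else if k == j then s * tnth z i - c * tnth z j else tnth z k); last first.
    by apply/funext => z /=; rewrite tnth_mktuple.
  case: (k == i).
    by apply: measurable_funD; apply: measurable_funM => //; exact: measurable_tnth.
  case: (k == j); last exact: measurable_tnth.
  by apply: measurable_funB; apply: measurable_funM => //; exact: measurable_tnth.
move=> B mB.
pose S (z : R * R) := (c * z.1 + s * z.2, s * z.1 - c * z.2).
transitivity (nu [set z | (S @^-1` (B i `*` B j)) (tnth z i, tnth z j) /\
              forall k, k != i -> k != j -> B k (tnth z k)]).
  congr (nu _); apply/seteqP; split => [z Bz|z [[Bi Bj] Bz] k] /=.
    split; first split => /=.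
    - by have := Bz i; rewrite tnth_mktuple eqxx.
    - by have := Bz j; rewrite tnth_mktuple eqxx eq_sym (negbTE ij).
    - by move=> k ki kj; have := Bz k; rewrite tnth_mktuple (negbTE ki) (negbTE kj).
  rewrite tnth_mktuple; have [->//|ki] := eqVneq k i; have [->//|kj] := eqVneq k j.
  exact: Bz.
rewrite gaussian_pair_indep//; last first.
  by rewrite -[X in measurable X]setTI; apply: mS => //; exact: measurableX.
rewrite gS; last exact: measurableX.
rewrite product_measure1E// /gauss_box [RHS](bigD1 i)//= [in RHS](bigD1 j)/=.
  by rewrite muleA.
by rewrite eq_sym.
Qed.

Definition flip (i : 'I_d) z : d.-tuple R :=
  [tuple if k == i then - tnth z k else tnth z k | k < d].

Lemma gaussian_flip i : law nu (flip i) nu.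
Proof.
apply: gaussian_law.
  apply/measurable_fun_tnthP => k.
  rewrite (_ : _ \o _ = fun z => if k == i then - tnth z k else tnth z k); last first.
    by apply/funext => z /=; rewrite tnth_mktuple.
  case: (k == i); last exact: measurable_tnth.
  by apply: measurable_funN; exact: measurable_tnth.
move=> B mB; have [mN gN] := @law_gauss_opp R.
have mNB k : measurable (-%R @^-1` B k).
  by rewrite -[X in measurable X]setTI; exact: mN.
transitivity (nu (box (fun k => if k == i then -%R @^-1` B k else B k))).
  congr (nu _); apply/seteqP; split => z Bz k; have := Bz k;
    by rewrite tnth_mktuple; case: ifP.
rewrite nug; last by move=> k; case: ifP.
by apply: eq_bigr => k _; case: ifP => // _; exact: gN.
Qed.

Definition householder w z : d.-tuple R :=
  [tuple tnth z k - 2 * dotv w (vec z) * w k | k < d].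

Lemma dotvC w p : dotv w p = dotv p w.
Proof. by apply: eq_bigr => i _; rewrite mulrC. Qed.

Lemma dotv2 i j w p : i != j -> dotv w p =
  w i * p i + w j * p j + \sum_(k | (k != i) && (k != j)) w k * p k.
Proof.
by move=> ij; rewrite /dotv (bigD1 i)//= (bigD1 j)/= ?addrA// eq_sym.
Qed.

(* Induction on the number of nonzero coordinates of [w]: conjugating by a planar
   reflection that merges two of them into one leaves a reflection along a vector
   of smaller support; support one is a sign flip. *)
Lemma gaussian_householder w : dotv w w = 1 -> law nu (householder w) nu.
Proof.
have [n] := ubnP #|[pred k | w k != 0]|; elim: n w => // n IH w wn w1.
have [i wi0] : exists i, w i != 0.
  apply/existsP; rewrite -negb_forall; apply/negP => /forallP w0.
  move: w1; rewrite /dotv big1 ?(eqP (oner_neq0 _))//.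
    by move/eqP; rewrite eq_sym oner_eq0.
  by move=> k _; rewrite (eqP (w0 k)) mul0r.
have [[j wj0 ij]|wi] := pselect (exists2 j, w j != 0 & i != j); last first.
  have w0 k : k != i -> w k = 0.
    by move=> ki; apply/eqP/negP => /negP wk; apply: wi; exists k; rewrite // eq_sym.
  rewrite (_ : householder w = flip i); first exact: gaussian_flip.
  have wi1 : w i * w i = 1.
    by move: w1; rewrite /dotv (bigD1 i)//= big1 ?addr0// => k /w0 ->; rewrite mul0r.
  apply/funext => z; apply/eq_from_tnth => k; rewrite !tnth_mktuple.
  case: eqP => [->|/eqP ki]; last by rewrite (w0 k ki) mulr0 subr0.
  rewrite /dotv (bigD1 i)//= big1 ?addr0; last by move=> l /w0 ->; rewrite mul0r.
  rewrite /vec; transitivity (tnth z i - 2 * (w i * w i) * tnth z i); first ring.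
  by rewrite wi1; ring.
(* The planar reflection with [c = w i / r] and [s = w j / r] sends [(w i, w j)] to [(r, 0)], so
   [w'] has lost the coordinate [j]. Being an involution, it serves on both sides of the
   conjugation; [w j != 0] gives [s != 0]. *)
pose r := Num.sqrt (w i ^+ 2 + w j ^+ 2).
have r2 : r ^+ 2 = w i ^+ 2 + w j ^+ 2 by rewrite sqr_sqrtr// addr_ge0// sqr_ge0.
have r0 : r != 0.
  rewrite -sqrf_eq0 r2 paddr_eq0 ?sqr_ge0// !sqrf_eq0.
  by rewrite (negbTE wi0).
pose c := w i / r; pose s := w j / r.
have wiE : w i = c * r by rewrite /c mulrVK ?unitfE.
have wjE : w j = s * r by rewrite /s mulrVK ?unitfE.
have cs1 : c ^+ 2 + s ^+ 2 = 1.
  by rewrite /c /s !expr_div_n -mulrDl -r2 divff// sqrf_eq0.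
have s0 : s != 0 by rewrite mulf_neq0// invr_eq0.
pose w' k := if k == i then r else if k == j then 0 else w k.
have w'i : w' i = r by rewrite /w' eqxx.
have w'j : w' j = 0 by rewrite /w' eqxx eq_sym (negbTE ij).
have w'k k : (k != i) && (k != j) -> w' k = w k.
  by rewrite /w' => /andP[/negbTE -> /negbTE ->].
have w'1 : dotv w' w' = 1.
  rewrite -w1 !(dotv2 _ _ ij) w'i w'j mul0r addr0 -expr2 r2 -!expr2; congr (_ + _).
  by apply: eq_bigr => k kij; rewrite w'k.
have w'n : (#|[pred k | w' k != 0%R]| < n)%N.
  rewrite -ltnS; apply: leq_trans wn; rewrite ltnS.
  apply: proper_card; apply/properP; split.
    apply/fintype.subsetP => k; rewrite !inE /w'.
    by have [->//|ki] := eqVneq k i; have [->//|kj] := eqVneq k j.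
  by exists j; rewrite !inE ?wj0// w'j eqxx.
have LS := gaussian_plane_refl ij cs1 s0.
have := law_comp LS (law_comp (IH _ w'n w'1) LS).
congr law; apply/funext => z; apply/eq_from_tnth => k.
have dE : dotv w' (vec (plane_refl i j c s z)) = dotv w (vec z).
  rewrite !(dotv2 _ _ ij) w'i w'j mul0r addr0; congr (_ + _).
    by rewrite /vec tnth_mktuple eqxx wiE wjE; ring.
  apply: eq_bigr => l lij; rewrite w'k// /vec tnth_mktuple.
  by case/andP: lij => /negbTE -> /negbTE ->.
rewrite /= !tnth_mktuple !dE w'i w'j !eqxx (eq_sym j i) (negbTE ij).
have [->|ki] := eqVneq k i.
  rewrite wiE -[X in _ = X - _]mul1r -cs1; ring.
have [->|kj] := eqVneq k j.
  rewrite wjE -[X in _ = X - _]mul1r -cs1; ring.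
by rewrite w'k ?ki ?kj.
Qed.

End gaussian.

End tuples.

(** * Transporting one projection of a Gaussian vector to another *)

Section dotv.
Context {R : realType} (d : nat).
Implicit Types (a b w p q : 'I_d -> R) (z : d.-tuple R).

Lemma dotvBl a b p : dotv (fun k => a k - b k) p = dotv a p - dotv b p.
Proof. by rewrite /dotv -sumrB; apply: eq_bigr => k _; rewrite mulrBl. Qed.

Lemma dotvZl (t : R) a p : dotv (fun k => t * a k) p = t * dotv a p.
Proof. by rewrite /dotv mulr_sumr; apply: eq_bigr => k _; rewrite mulrA. Qed.

Lemma dotv_ge0 a : 0 <= dotv a a.
Proof. by apply: sumr_ge0 => k _; rewrite -expr2 sqr_ge0. Qed.

Lemma dotv_eq0 a : dotv a a = 0 -> a = fun=> 0.
Proof.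
move=> a0; apply/funext => k; apply/eqP; rewrite -sqrf_eq0 expr2.
move/eqP : a0; rewrite psumr_eq0 => [/allP/(_ k (mem_index_enum k))//|i _].
by rewrite -expr2 sqr_ge0.
Qed.

Lemma vec_householder w z :
  vec (householder w z) = fun k => vec z k - 2 * dotv w (vec z) * w k.
Proof. by apply/funext => k; rewrite /vec tnth_mktuple. Qed.

Lemma gaussian_transport (nu : probability (d.-tuple R) R) p q :
  gaussian nu -> dotv p p = 1 -> dotv q q = 1 ->
  exists (T : d.-tuple R -> d.-tuple R) (w : 'I_d -> R), [/\ law nu T nu,
    dotv w w = 1,
    forall z, dotv q (vec (T z)) = dotv p (vec z),
    forall z, dotv (vec (T z)) (vec (T z)) = dotv (vec z) (vec z) &
    forall z, `|dotv (vec z) (vec (T z)) - dotv (vec z) (vec z)| <=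
              2 * dotv w (vec z) ^+ 2].
Proof.
move=> nug p1 q1; have [pq|pq] := pselect (p = q).
  (* The difference [p - q] cannot be normalized here. The identity has no rank-one term, which is
     why the last clause is an inequality; any unit vector may then serve as [w]. *)
  exists id, p; split=> // z.
  - by rewrite pq.
  - by rewrite subrr normr0 mulr_ge0// sqr_ge0.
pose v k := p k - q k.
have v0 : dotv v v != 0.
  apply/eqP => /dotv_eq0 v0; apply: pq; apply/funext => k.
  by apply/eqP; rewrite -subr_eq0; apply/eqP; exact: (congr1 (fun f => f k) v0).
pose r := Num.sqrt (dotv v v).
have r2 : r ^+ 2 = dotv v v by rewrite sqr_sqrtr// dotv_ge0.
have r0 : r != 0 by rewrite -sqrf_eq0 r2.
pose w k := r^-1 * v k.
have w1 : dotv w w = 1.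
  by rewrite /w dotvZl dotvC dotvZl mulrA -r2 -expr2 -exprMn mulVf// expr1n.
(* Equal norms of [p] and [q] make [|p - q|^2 = - 2 (p - q).q]; this is what lets the reflection
   exchange the two vectors. *)
have vq : dotv v q = - r ^+ 2 / 2.
  have := r2; rewrite dotvBl ![dotv _ v]dotvC !dotvBl p1 q1 (dotvC q p) => ->.
  by rewrite (dotvC p q); field.
have wq : dotv w q = - r / 2 by rewrite /w dotvZl vq; field.
have wr a : r * dotv w a = dotv p a - dotv q a.
  by rewrite /w dotvZl dotvBl mulrA divff// mul1r.
clearbody w.
exists (householder w), w; split => // [|z|z|z].
- exact: gaussian_householder.
- rewrite vec_householder dotvC dotvBl dotvZl wq (dotvC _ q).
  by have := wr (vec z); lra.
- rewrite vec_householder dotvBl dotvZl ![dotv _ (fun k => _ - _)]dotvC.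
  rewrite !dotvBl !dotvZl w1 (dotvC _ w); ring.
- rewrite vec_householder dotvC dotvBl dotvZl (_ : _ - _ = - (2 * dotv w (vec z) ^+ 2)); last by ring.
  by rewrite normrN ger0_norm// mulr_ge0// sqr_ge0.
Qed.

(** Transporting [p] to a basis vector turns the projection into a coordinate, whose law is read off
    the boxes. *)
Lemma gaussian_dotv (nu : probability (d.-tuple R) R) p :
  gaussian nu -> dotv p p = 1 ->
  law nu (fun z => dotv p (vec z)) (gauss R).
Proof.
move=> nug p1.
have [i _] : exists i : 'I_d, True.
  case: d p p1 {nug nu} => [|n] p p1; last by exists ord0.
  by move: p1; rewrite /dotv big_ord0 => /eqP; rewrite eq_sym oner_eq0.
pose e k : R := (k == i)%:R.
have eE (a : 'I_d -> R) : dotv e a = a i.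
  rewrite /dotv (bigD1 i)//= /e eqxx mul1r big1 ?addr0// => k /negbTE ->.
  by rewrite mul0r.
have e1 : dotv e e = 1 by rewrite eE /e eqxx.
have [T [w [lT _ Tp _ _]]] := gaussian_transport nug p1 e1.
have := law_comp lT (gaussian_coord nug i); congr law.
by apply/funext => z /=; rewrite -Tp eE.
Qed.

End dotv.

Lemma law_exists (R : realType) d1 d2 (T1 : measurableType d1)
    (T2 : measurableType d2) (P : probability T1 R) (f : T1 -> T2) :
  measurable_fun setT f -> exists Q : probability T2 R, law P f Q.
Proof.
move=> mf.
exists (distribution P (mfun_Sub (mem_set mf) : {mfun T1 >-> T2})).
by split.
Qed.

(** Adds one independent coordinate at a time, starting from the point mass at the empty tuple. The
    lower bound needs an actual Gaussian vector from which to build a coupling. *)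
Lemma gaussian_exists (R : realType) d :
  exists nu : probability (d.-tuple R) R, gaussian nu.
Proof.
elim: d => [|d [nu nug]].
  exists (\d_ [tuple])%E => B mB; rewrite /gauss_box big_ord0.
  have -> : box B = setT by apply/seteqP; split => // z _ [].
  exact: probability_setT.
pose f (x : R * d.-tuple R) := [tuple of x.1 :: x.2].
have mf : measurable_fun setT f by exact: measurable_cons.
have [Q [_ QE]] := law_exists (gauss R \x nu)%E mf.
exists Q => B mB; rewrite -QE; last exact: measurable_box.
transitivity ((gauss R \x nu)%E (B ord0 `*` box (fun i => B (lift ord0 i)))).
  congr ((gauss R \x nu)%E _); apply/seteqP; split => -[x z] /=.
    move=> Bx; split => /=; first by have := Bx ord0.
    by move=> i; have := Bx (lift ord0 i); rewrite /f tnthS.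
  move=> [/= Bx Bz] i; case: (unliftP ord0 i) => [j|] ->//=.
  by rewrite tnthS.
transitivity (gauss R (B ord0) * nu (box (fun i => B (lift ord0 i))))%E.
  by apply: product_measure1E => //; exact: measurable_box.
by rewrite nug// /gauss_box big_ord_recl.
Qed.

(** The change of variables for signed integrands, such as products of centred squares and the cross
    term. *)
Lemma integral_law_integrable (R : realType) d1 d2 (T1 : measurableType d1)
    (T2 : measurableType d2)
    (mu : {measure set T1 -> \bar R}) (nu : {measure set T2 -> \bar R})
    (f : T1 -> T2) (g : T2 -> \bar R) :
  law mu f nu -> measurable_fun setT g -> mu.-integrable setT (g \o f) ->
  (\int[mu]_x g (f x) = \int[nu]_y g y)%E.
Proof.
move=> [mf fmu] mg ig.
transitivity (\int[pushforward mu f]_y g y)%E.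
  by rewrite integral_pushforward.
by apply: eq_measure_integral => A mA _; exact: fmu.
Qed.

(** * Concentration of the squared norm of a Gaussian vector *)

Section norm_deviation.
Context {R : realType}.
Local Notation gamma := (gauss R).
Let xi (z : R) : R := z ^+ 2 - 1.

Let mxi : measurable_fun setT xi.
Proof. by apply: measurable_funB => //; exact: measurable_funX. Qed.

Let integrable_sqr : gamma.-integrable setT (fun z => (z ^+ 2)%:E).
Proof.
apply/integrableP; split; first exact/measurable_EFinP/measurable_funX.
under eq_integral do rewrite gee0_abs ?lee_fin ?sqr_ge0//.
exact: integral_sqr_lty.
Qed.

Let integral_xi : (\int[gamma]_z (xi z)%:E = 0)%E.
Proof.
under eq_integral do rewrite /xi EFinB.
rewrite integralB//=; last exact: finite_measure_integrable_cst.
by rewrite integral_sqr integral_prob_cst -EFinB subrr.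
Qed.

Section pairs.
Variables (d : nat) (nu : probability (d.-tuple R) R) (nug : gaussian nu).
Let X i (z : d.-tuple R) := xi (tnth z i).

Let mX i : measurable_fun setT (X i).
Proof. by apply: (measurableT_comp mxi); exact: measurable_tnth. Qed.

Let integral_X2 i : (\int[nu]_z (X i z ^+ 2)%:E = \int[gamma]_z (xi z ^+ 2)%:E)%E.
Proof.
rewrite -(integral_law (gaussian_coord nug i))//.
  by apply/measurable_EFinP; exact: measurable_funX.
by move=> z; rewrite lee_fin sqr_ge0.
Qed.

(** Dominated by [X i ^ 2 + X j ^ 2], which the fourth-moment bound makes integrable. *)
Let integrable_XX i j : nu.-integrable setT (fun z => (X i z * X j z)%:E).
Proof.
have iX2 k : nu.-integrable setT (fun z => (X k z ^+ 2)%:E).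
  apply/integrableP; split; first by apply/measurable_EFinP; exact: measurable_funX.
  under eq_integral do rewrite gee0_abs ?lee_fin ?sqr_ge0//.
  by rewrite integral_X2; exact: integral_sqrB1_sqr_lty.
apply: (@le_integrable _ _ _ nu _ measurableT _ (fun z => (X i z ^+ 2)%:E + (X j z ^+ 2)%:E)%E).
- by apply/measurable_EFinP; exact: measurable_funM.
- move=> z _; rewrite -EFinD !abse_EFin lee_fin (ger0_norm (addr_ge0 _ _)) ?sqr_ge0//.
  rewrite ler_norml; apply/andP; split.
    have := sqr_ge0 (X i z + X j z); have := sqr_ge0 (X i z); have := sqr_ge0 (X j z); nra.
  have := sqr_ge0 (X i z - X j z); have := sqr_ge0 (X i z); have := sqr_ge0 (X j z); nra.
- exact: integrableD.
Qed.

(** Two distinct coordinates have the product law, and under Fubini the inner integral of the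
    centred factor vanishes. *)
Let integral_XX i j : i != j -> (\int[nu]_z (X i z * X j z)%:E = 0)%E.
Proof.
move=> ij; have L := gaussian_pair nug ij.
pose g (z : R * R) := (xi z.1 * xi z.2)%:E.
have mg : measurable_fun setT g.
  by apply/measurable_EFinP; apply: measurable_funM; exact: measurableT_comp.
rewrite (integral_law_integrable (g := g) L)//; last exact: integrable_XX.
rewrite -(@integral12_prod_meas1 _ _ _ _ _ gamma gamma).
  rewrite integral0_eq// => x _; rewrite /fubini_F/= /g/=.
  under eq_integral do rewrite EFinM.
  rewrite integralZl//; first by rewrite integral_xi mule0.
  under [X in integrable _ _ X]eq_fun do rewrite /xi EFinB.
  by apply: integrableB => //; exact: finite_measure_integrable_cst.
apply/integrableP; split => //.
rewrite -(integral_law L); [|exact: measurableT_comp|by move=> z; exact: abse_ge0].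
by have /integrableP[] := integrable_XX i j.
Qed.

(** The deviation is a sum of centred, pairwise uncorrelated variables of common variance [K], so
    only the diagonal of the expanded square survives. *)
Lemma gaussian_normsq_variance K :
  (\int[gamma]_z (xi z ^+ 2)%:E = K%:E)%E ->
  (\int[nu]_z ((dotv (vec z) (vec z) - d%:R) ^+ 2)%:E =
   (K *+ d)%:E)%E.
Proof.
move=> KE.
transitivity (\int[nu]_z (\sum_(i < d) \sum_(j < d) (X i z * X j z)%:E))%E.
  apply: eq_integral => z _.
  under eq_bigr do rewrite sumEFin -mulr_sumr.
  rewrite sumEFin -mulr_suml; congr (_%:E).
  rewrite /X /xi sumrB sumr_const card_ord expr2; congr (_ * _);
    by congr (_ - _); apply: eq_bigr => i _; rewrite /vec expr2.
rewrite integral_sum//; last by move=> i; exact: integrable_sum.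
under eq_bigr => i _.
  rewrite integral_sum// (bigD1 i)//= big1 => [|j ji]; last first.
    by rewrite integral_XX// eq_sym.
  rewrite adde0; under eq_integral do rewrite -expr2.
  rewrite integral_X2 KE; over.
by rewrite sumEFin sumr_const card_ord.
Qed.

End pairs.

(* [|t| <= (t^2 / s + s) / 2] with [s = sqrt d], applied to a variable of variance
   [O(d)]. *)
Lemma gaussian_normsq_dev : exists C : R,
  forall d (nu : probability (d.-tuple R) R), (0 < d)%N -> gaussian nu ->
  (\int[nu]_z `|dotv (vec z) (vec z) - d%:R|%:E <= (C * Num.sqrt d%:R)%:E)%E.
Proof.
have [K K0 KE] := ge0_integral_fineK (fun z => sqr_ge0 (xi z)) integral_sqrB1_sqr_lty.
(* Integrating the pointwise bound gives [K d / (2 s) + s / 2], and [d = s^2]. *)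
exists ((K + 1) / 2).
move=> d nu d0 nug; set s := Num.sqrt _.
have s0 : 0 < s by rewrite sqrtr_gt0 ltr0n.
have s2 : s ^+ 2 = d%:R by rewrite sqr_sqrtr.
have mD : measurable_fun [set: d.-tuple R] (fun z => dotv (vec z) (vec z) - d%:R).
  by apply: measurable_funB => //; apply: measurable_fun_dotv => i; exact: measurable_vec.
apply: (@le_trans _ _ (\int[nu]_z ((2 * s)^-1 * (dotv (vec z) (vec z) - d%:R) ^+ 2 + s / 2)%:E)%E).
  apply: ge0_le_integral_EFin => //.
  - exact: measurableT_comp.
  - by apply: measurable_funD => //; apply: measurable_funM => //; exact: measurable_funX.
  - move=> z; set t := _ - _.
    rewrite -(@ler_pM2l _ (2 * s)) ?mulr_gt0// mulrDr mulrA divff ?mulf_neq0 ?gt_eqF//.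
    rewrite mul1r -[t ^+ 2]real_normK ?num_real//.
    have := sqr_ge0 (`|t| - s); nra.
rewrite ge0_integral_EFinD//; last 3 first.
- by apply: measurable_funM => //; exact: measurable_funX.
- by move=> z; rewrite mulr_ge0 ?sqr_ge0// invr_ge0 mulr_ge0// ltW.
- by move=> z; rewrite divr_ge0// ltW.
rewrite integral_prob_cst ge0_integral_EFinZ//; last 3 first.
- exact: measurable_funX.
- by move=> z; exact: sqr_ge0.
- by rewrite invr_ge0 mulr_ge0// ltW.
rewrite (gaussian_normsq_variance nug KE) -EFinM -EFinD lee_fin.
rewrite -[K *+ d]mulr_natl -s2 le_eqVlt; apply/orP; left; apply/eqP; field.
by rewrite gt_eqF.
Qed.

End norm_deviation.

(** * Acceptance probabilities *)

Section acceptance.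
Context {R : realType}.
Implicit Types (s t u v a b c : R).

Definition min1 u v : R := Num.min 1 (Num.min (expR u) (expR v)).

Lemma min1_ge0 u v : 0 <= min1 u v.
Proof. by rewrite /min1 !le_min ler01 !expR_ge0. Qed.

Lemma min1_le1 u v : min1 u v <= 1.
Proof. by rewrite /min1 ge_min lexx. Qed.

Lemma min1C u v : min1 u v = min1 v u.
Proof. by rewrite /min1 (minC (expR u)). Qed.

Lemma min1E u v : min1 u v = expR (Num.min 0 (Num.min u v)).
Proof.
have expR_min a b : expR (Num.min a b) = Num.min (expR a) (expR b).
  by case: (leP a b) => ab; [rewrite min_l ?ler_expR|rewrite min_r ?ler_expR// ltW].
by rewrite /min1 !expR_min expR0.
Qed.

(** [min1] is [exp] of a nonpositive minimum: the minimum moves by no more than the two changes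
    together, and [exp] has slope at most 1 on nonpositive arguments. *)
Lemma min1_lip u v u' v' : min1 u v <= min1 u' v' + (`|u - u'| + `|v - v'|).
Proof.
rewrite !min1E; set n := Num.min 0 _; set n' := Num.min 0 _.
have n0 : n <= 0 by rewrite /n ge_min lexx.
have nn' : n <= n' + (`|u - u'| + `|v - v'|).
  have nu : n <= u by rewrite /n !ge_min lexx orbT.
  have nv : n <= v by rewrite /n !ge_min lexx !orbT.
  have := ler_norm (u - u'); have := ler_norm (v - v').
  have := normr_ge0 (u - u'); have := normr_ge0 (v - v').
  move: (`|_|) (`|_|) => e1 e2 *; rewrite -lerBlDr /n' !le_min.
  by apply/andP; split; [|apply/andP; split]; lra.
have [nn|nn] := leP n n'.
  by apply: (le_trans (y := expR n')); rewrite ?ler_expR// lerDl addr_ge0.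
have e1 : expR n <= 1 by rewrite -expR0 ler_expR.
have e0 := expR_gt0 n.
have : expR n * (1 + (n' - n)) <= expR n'.
  by rewrite -[X in _ <= expR X](subrKC n) expRD ler_pM2l// expR_ge1Dx.
have : 0 <= (1 - expR n) * (n - n') by rewrite mulr_ge0// subr_ge0// ltW.
lra.
Qed.

Lemma measurable_min1 d (T : measurableType d) (f g : T -> R) :
  measurable_fun setT f -> measurable_fun setT g ->
  measurable_fun setT (fun x => min1 (f x) (g x)).
Proof.
move=> mf mg; apply: measurable_minr => //.
by apply: measurable_minr; exact: measurableT_comp.
Qed.

(* The two functions of [s] in [min1] cross at [s = 0], where both equal
   [exp (- c)]; cutting them at this level yields an optimal pair of dual
   potentials for the comonotone coupling. *)
Lemma min1_dual a b c : 0 <= c -> 0 <= a -> 0 <= b ->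
  exists Phi Psi : R -> R, [/\ measurable_fun setT Phi /\ (forall s, 0 <= Phi s),
    measurable_fun setT Psi /\ (forall s, 0 <= Psi s),
    forall s t, min1 (- (a * s) - c) (- (b * t) - c) <= Phi s + Psi t &
    forall s, min1 (- (a * s) - c) (- (b * s) - c) = Phi s + Psi s].
Proof.
move=> c0; wlog ab : a b / a <= b.
  move=> H a0 b0; have [ab|/ltW ba] := leP a b; first exact: H.
  have [Phi [Psi [HPhi HPsi le_sum eq_sum]]] := H _ _ ba b0 a0.
  exists Psi, Phi; split => // [s t|s]; first by rewrite [leRHS]addrC min1C.
  by rewrite [RHS]addrC min1C.
move=> a0 b0; pose k := expR (- c).
have mexp r : measurable_fun setT (fun s : R => expR (- (r * s) - c)).
  apply: measurableT_comp => //; apply: measurable_funB => //.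
  by apply: measurable_funN; exact: measurable_funM.
have k0 : 0 < k by exact: expR_gt0.
have k1 : k <= 1 by rewrite -expR0 ler_expR; lra.
(* Here [a <= b]. For [s <= 0] the diagonal value is [1 /\ exp (- a s - c)], at least [k]; for
   [s > 0] it is [exp (- b s - c)], at most [k]. [Phi] carries the excess over [k] and [Psi] the
   part below it. *)
exists (fun s => Num.max 0 (Num.min 1 (expR (- (a * s) - c)) - k)).
exists (fun t => Num.min (expR (- (b * t) - c)) k).
split.
- split; last by move=> s; rewrite le_max lexx.
  apply: measurable_maxr => //; apply: measurable_funB => //.
  exact: measurable_minr.
- split; last by move=> s; rewrite le_min expR_ge0 ltW.
  exact: measurable_minr.
- move=> s t; rewrite /min1.
  move: (expR (- (a * s) - c)) (expR (- (b * t) - c)) => A B.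
  case: (leP B k) => Bk.
    apply: (@le_trans _ _ B); first by rewrite !ge_min lexx !orbT.
    by rewrite lerDr le_max lexx.
  apply: (@le_trans _ _ (Num.min 1 A)).
    by rewrite minA ge_min lexx.
  by rewrite -lerBlDr le_max lexx orbT.
- move=> s; rewrite /min1.
  have [s0|s0] := leP s 0.
    have kA : k <= expR (- (a * s) - c) by rewrite ler_expR; nra.
    have AB : expR (- (a * s) - c) <= expR (- (b * s) - c) by rewrite ler_expR; nra.
    rewrite (min_l AB) (min_r (le_trans kA AB)) max_r; first by rewrite subrK.
    by rewrite subr_ge0 le_min k1.
  have kA : expR (- (a * s) - c) <= k by rewrite ler_expR; nra.
  have AB : expR (- (b * s) - c) <= expR (- (a * s) - c) by rewrite ler_expR; nra.
  rewrite (min_r AB) (min_l (le_trans AB kA)) max_l.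
    by rewrite add0r min_r// (le_trans AB)// (le_trans kA).
  by rewrite subr_le0 ge_min kA orbT.
Qed.

Definition unif : probability R R := onR (uniform_prob (@ltr01 R)).

Lemma unif_le t : 0 <= t -> unif [set u | u <= t] = (Num.min 1 t)%:E.
Proof.
move=> t0; rewrite -[LHS]/(uniform_prob (@ltr01 R) [set u | u <= t]).
rewrite /uniform_prob integral_uniform_pdf.
rewrite (_ : _ `&` _ = `[0, Num.min 1 t]%classic); last first.
  apply/seteqP; split => u /=; rewrite !in_itv/= le_min.
    by move=> [-> /andP[-> ->]].
  by move=> /andP[-> /andP[-> ->]].
rewrite (eq_integral (fun=> 1%E)); last first.
  move=> u; rewrite inE/= in_itv/= le_min => /andP[u0 /andP[u1 ut]].
  by rewrite /uniform_pdf u0 u1 subr0 invr1.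
rewrite integral_cst//= mul1e lebesgue_measure_itv/= lte_fin.
case: ltP => [_|]; first by rewrite -EFinD subr0.
by move=> m0; congr (_%:E); apply/eqP; rewrite eq_le m0 le_min ler01 t0.
Qed.

Lemma unif_le_expR u : unif [set t | t <= expR u] = (Num.min 1 (expR u))%:E.
Proof. by rewrite unif_le// expR_ge0. Qed.

End acceptance.

Lemma law_snd (R : realType) d1 d2 (T1 : measurableType d1)
    (T2 : measurableType d2) (P : probability T1 R) (Q : probability T2 R) :
  law (P \x Q)%E snd Q.
Proof.
split; first exact: measurable_snd.
move=> A mA; transitivity ((P \x Q)%E (setT `*` A)).
  by congr ((P \x Q)%E _); apply/seteqP; split => // z [].
transitivity (P setT * Q A)%E; first exact: product_measure1E.
by rewrite -[RHS]mul1e; congr (_ * _)%E; exact: probability_setT.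
Qed.

(** Bounds a signed integrand from above before its integrability is known: the integral is at most
    that of the positive part, which [g] dominates. *)
Lemma le_integral_ge0 (R : realType) d (T : measurableType d)
    (mu : {measure set T -> \bar R}) (f g : T -> R) :
  measurable_fun setT f -> measurable_fun setT g ->
  (forall x, 0 <= g x) -> (forall x, f x <= g x) ->
  (\int[mu]_x (f x)%:E <= \int[mu]_x (g x)%:E)%E.
Proof.
move=> mf mg g0 fg; rewrite integralE.
apply: (@le_trans _ _ (\int[mu]_x (((fun x => (f x)%:E)^\+) x))%E).
  by apply: geeDl; rewrite leeNl oppe0 integral_ge0.
apply: ge0_le_integral => //.
- exact/measurable_funepos/measurable_EFinP.
- exact/measurable_EFinP.
- by move=> x _; rewrite funeposE ge_max !lee_fin fg g0.
Qed.

Section limit_constant.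
Context {R : realType} (l x y : R).
Let a := l * Num.sqrt x.
Let b := l * Num.sqrt y.
Let c := l ^+ 2 / 2.

Lemma measurable_min1_affine : measurable_fun [set: R]
  (fun s => min1 (- (a * s) - c) (- (b * s) - c)).
Proof.
by apply: measurable_min1; apply: measurable_funB => //; apply: measurable_funN;
  exact: measurable_funM.
Qed.

Lemma limit_valueE : exists2 M : R, limit_value l x y = (l ^+ 2 * M)%:E &
  (\int[gauss R]_s (min1 (- (a * s) - c) (- (b * s) - c))%:E = M%:E)%E.
Proof.
have [|M M0 ME] := @ge0_integral_fineK R _ _ (gauss R)
    (fun s => min1 (- (a * s) - c) (- (b * s) - c)) (fun s => min1_ge0 _ _).
  apply: (@le_lt_trans _ _ (\int[gauss R]_s 1%:E)%E).
    apply: ge0_le_integral_EFin => // [|s|s]; [exact: measurable_min1_affine| |].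
      exact: min1_ge0.
    exact: min1_le1.
  by rewrite integral_prob_cst ltry.
exists M => //; rewrite EFinM -ME /limit_value; congr (_ * _)%E.
rewrite integral_onR => [//||s].
  by apply/measurable_EFinP; exact: measurable_min1_affine.
by rewrite lee_fin min1_ge0.
Qed.

End limit_constant.

(** * Estimates at a fixed dimension *)

Section core.
Context {R : realType} (d : nat) (l x y C : R) (X Y : d.-tuple R).
Hypothesis d0 : (0 < d)%N.
Hypothesis l0 : 0 < l.
Let h := l / Num.sqrt d%:R.
Let a := l * Num.sqrt x.
Let b := l * Num.sqrt y.
Let c := l ^+ 2 / 2.
Variable M : R.
Hypothesis ME :
  (\int[gauss R]_s (min1 (- (a * s) - c) (- (b * s) - c))%:E = M%:E)%E.
Let sd : R := Num.sqrt d%:R.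
(** Sum of two errors: [l^2 * (l^2 C / sd)] from replacing the squared norms by [d] inside the
    acceptance probabilities, and [l^2 C / sd] from replacing [h^2 Zx.Zy] by [l^2]. *)
Let err := (l ^+ 2 + l ^+ 4) * C / sd.

(** Logarithm of the ratio of the standard Gaussian density at [X + h Z] to that at [X]. *)
Definition log_ratio (h : R) (X Z : 'I_d -> R) : R :=
  - (h * dotv X Z) - h ^+ 2 * dotv Z Z / 2.

Definition both_accept (u1 u2 s t : R) : R :=
  (u1 <= expR s)%R%:R * (u2 <= expR t)%R%:R.

Lemma both_accept_ge0 u1 u2 s t : 0 <= both_accept u1 u2 s t.
Proof. by rewrite mulr_ge0. Qed.

Lemma both_accept_le1 u1 u2 s t : both_accept u1 u2 s t <= 1.
Proof. by rewrite /both_accept -natrM mulnb lern1 leq_b1. Qed.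

Lemma cross_termE u1 u2 Zx Zy :
  cross_term h (vec X) (vec Y) u1 Zx u2 Zy =
  h ^+ 2 * dotv Zx Zy *
  both_accept u1 u2 (log_ratio h (vec X) Zx) (log_ratio h (vec Y) Zy).
Proof.
rewrite /cross_term /accept /both_accept /log_ratio mulrA; congr (_ * _ * _);
  by case: ifP.
Qed.

Let sd0 : 0 < sd. Proof. by rewrite sqrtr_gt0 ltr0n. Qed.
Let sd2 : sd ^+ 2 = d%:R. Proof. by rewrite sqr_sqrtr. Qed.
Let h2d : h ^+ 2 * d%:R = l ^+ 2.
Proof. by rewrite -sd2 /h -/sd; field; rewrite gt_eqF. Qed.
Let h2sd : h ^+ 2 * sd = l ^+ 2 / sd.
Proof. by rewrite /h -/sd; field; rewrite gt_eqF. Qed.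

(** As [h^2 d = l^2], the quantity [- (k s) - c] is the log ratio with [|Z|^2] replaced by [d]. *)
Lemma log_ratio_dev (V Z : 'I_d -> R) k s : h * dotv V Z = k * s ->
  `|log_ratio h V Z - (- (k * s) - c)| = h ^+ 2 / 2 * `|dotv Z Z - d%:R|.
Proof.
move=> hk; rewrite /log_ratio hk /c -h2d.
have -> : - (k * s) - h ^+ 2 * dotv Z Z / 2 - (- (k * s) - h ^+ 2 * d%:R / 2) =
  - (h ^+ 2 / 2 * (dotv Z Z - d%:R)) by ring.
by rewrite normrN normrM ger0_norm// divr_ge0// sqr_ge0.
Qed.

Lemma measurable_log_ratio d' (T : measurableType d') (V : 'I_d -> R)
    (Z : T -> 'I_d -> R) : (forall i, measurable_fun setT (Z ^~ i)) ->
  measurable_fun setT (fun w => log_ratio h V (Z w)).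
Proof.
move=> mZ; apply: measurable_funB.
  by apply: measurable_funN; apply: measurable_funM => //; exact: measurable_fun_dotv.
by apply: measurable_funM => //; apply: measurable_funM => //; exact: measurable_fun_dotv.
Qed.

Lemma measurable_both_accept d' (T : measurableType d') (u1 u2 s t : T -> R) :
  measurable_fun setT u1 -> measurable_fun setT u2 ->
  measurable_fun setT s -> measurable_fun setT t ->
  measurable_fun setT (fun w => both_accept (u1 w) (u2 w) (s w) (t w)).
Proof.
have mle (u v : T -> R) : measurable_fun setT u -> measurable_fun setT v ->
    measurable_fun setT (fun w => (u w <= expR (v w))%R%:R : R).
  move=> mu mv; rewrite (_ : (fun w => _) = (fun w => if u w <= expR (v w) then 1 else 0)).
    apply: measurable_fun_ifT => //; apply: measurable_fun_ler => //.
    exact: measurableT_comp.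
  by apply/funext => w; case: ifP.
by move=> m1 m2 m3 m4; apply: measurable_funM; exact: mle.
Qed.

Lemma measurable_cross_term d' (T : measurableType d') (u1 u2 : T -> R)
    (Zx Zy : T -> 'I_d -> R) :
  measurable_fun setT u1 -> measurable_fun setT u2 ->
  (forall i, measurable_fun setT (Zx ^~ i)) ->
  (forall i, measurable_fun setT (Zy ^~ i)) ->
  measurable_fun setT (fun w =>
    cross_term h (vec X) (vec Y) (u1 w) (Zx w) (u2 w) (Zy w)).
Proof.
move=> mu1 mu2 mZx mZy; under eq_fun do rewrite cross_termE.
apply: measurable_funM.
  by apply: measurable_funM => //; exact: measurable_fun_dotv.
by apply: measurable_both_accept => //; exact: measurable_log_ratio.
Qed.

(** * Couplings with one uniform variable and a common projection [g] *)

Section shared_uniform.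
Context d' (W : measurableType d') (nu : probability W R).
Variables (zx zy : W -> 'I_d -> R) (g : W -> R).
Hypotheses (mzx : forall i, measurable_fun setT (zx ^~ i))
  (mzy : forall i, measurable_fun setT (zy ^~ i)) (lg : law nu g (gauss R)).
Hypotheses (Xg : forall w, h * dotv (vec X) (zx w) = a * g w)
  (Yg : forall w, h * dotv (vec Y) (zy w) = b * g w).
Hypotheses
  (devx : (\int[nu]_w `|dotv (zx w) (zx w) - d%:R|%:E <= (C * sd)%:E)%E)
  (devy : (\int[nu]_w `|dotv (zy w) (zy w) - d%:R|%:E <= (C * sd)%:E)%E)
  (devxy : (\int[nu]_w `|dotv (zx w) (zy w) - d%:R|%:E <= (C * sd)%:E)%E).

Let ex w := log_ratio h (vec X) (zx w).
Let ey w := log_ratio h (vec Y) (zy w).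
Let mex : measurable_fun setT ex. Proof. exact: measurable_log_ratio. Qed.
Let mey : measurable_fun setT ey. Proof. exact: measurable_log_ratio. Qed.

Let mdev (z z' : W -> 'I_d -> R) : (forall i, measurable_fun setT (z ^~ i)) ->
  (forall i, measurable_fun setT (z' ^~ i)) ->
  measurable_fun setT (fun w => `|dotv (z w) (z' w) - d%:R|).
Proof.
move=> mz mz'; apply: measurableT_comp => //; apply: measurable_funB => //.
exact: measurable_fun_dotv.
Qed.

Let lim w := min1 (- (a * g w) - c) (- (b * g w) - c).
Let mlim : measurable_fun setT lim.
Proof. by apply: (measurableT_comp (@measurable_min1_affine R l x y)); case: lg. Qed.

Let integral_lim : (\int[nu]_w (lim w)%:E = M%:E)%E.
Proof.
rewrite -ME -(integral_law lg (g := fun s => (min1 (- (a * s) - c) (- (b * s) - c))%:E))//.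
  by apply/measurable_EFinP; exact: measurable_min1_affine.
by move=> s; rewrite lee_fin min1_ge0.
Qed.

Let dev w := h ^+ 2 / 2 * `|dotv (zx w) (zx w) - d%:R| +
             h ^+ 2 / 2 * `|dotv (zy w) (zy w) - d%:R|.
Let h22 : 0 <= h ^+ 2 / 2. Proof. by rewrite divr_ge0// sqr_ge0. Qed.
Let dev_ge0 w : 0 <= dev w.
Proof. by rewrite addr_ge0// mulr_ge0. Qed.
Let measurable_dev : measurable_fun setT dev.
Proof. by apply: measurable_funD; apply: measurable_funM => //; exact: mdev. Qed.

Let integral_dev : (\int[nu]_w (dev w)%:E <= (l ^+ 2 * C / sd)%:E)%E.
Proof.
rewrite ge0_integral_EFinD//; last 4 first.
- by apply: measurable_funM => //; exact: mdev.
- by move=> w; rewrite mulr_ge0.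
- by apply: measurable_funM => //; exact: mdev.
- by move=> w; rewrite mulr_ge0.
rewrite !ge0_integral_EFinZ//; [|exact: mdev|exact: mdev].
rewrite (_ : l ^+ 2 * C / sd = h ^+ 2 / 2 * (C * sd) + h ^+ 2 / 2 * (C * sd)).
  by rewrite EFinD (EFinM (h ^+ 2 / 2)); apply: leeD; apply: lee_wpmul2l; rewrite ?lee_fin.
by rewrite mulrAC -h2sd; field.
Qed.

Let min1_near_lim w : min1 (ex w) (ey w) <= lim w + dev w /\
  lim w <= min1 (ex w) (ey w) + dev w.
Proof.
rewrite /dev -(log_ratio_dev (Xg w)) -(log_ratio_dev (Yg w)) -/(ex w) -/(ey w).
split; first exact: min1_lip.
by rewrite (distrC (ex w)) (distrC (ey w)); exact: min1_lip.
Qed.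

Let integral_min1 : exists2 m : R, (\int[nu]_w (min1 (ex w) (ey w))%:E = m%:E)%E &
  M - l ^+ 2 * C / sd <= m <= M + l ^+ 2 * C / sd.
Proof.
have mm : measurable_fun setT (fun w => min1 (ex w) (ey w)) by exact: measurable_min1.
have ub : (\int[nu]_w (min1 (ex w) (ey w))%:E <= (M + l ^+ 2 * C / sd)%:E)%E.
  apply: (@le_trans _ _ (\int[nu]_w (lim w + dev w)%:E)%E).
    apply: ge0_le_integral_EFin => // [w||w]; first exact: min1_ge0.
      exact: measurable_funD.
    by have [] := min1_near_lim w.
  rewrite ge0_integral_EFinD//; last by move=> w; exact: min1_ge0.
  by rewrite integral_lim EFinD leeD2l.
have [|m m0 mE] := @ge0_integral_fineK R _ _ nu _ (fun w => min1_ge0 (ex w) (ey w)).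
  by rewrite (le_lt_trans ub) ?ltry.
exists m => //; rewrite -[X in _ && X]lee_fin -mE ub andbT lerBlDr.
rewrite -lee_fin -integral_lim.
apply: (@le_trans _ _ (\int[nu]_w (min1 (ex w) (ey w) + dev w)%:E)%E).
  apply: ge0_le_integral_EFin => // [w||w]; first exact: min1_ge0.
    exact: measurable_funD.
  by have [] := min1_near_lim w.
rewrite ge0_integral_EFinD//; last by move=> w; exact: min1_ge0.
by rewrite mE EFinD leeD2l.
Qed.

Let P := (unif \x nu : probability (R * W)%type R)%E.
Let acc (w : R * W) := both_accept w.1 w.1 (ex w.2) (ey w.2).
Let macc : measurable_fun setT acc.
Proof.
apply: measurable_both_accept => //.
  exact: (measurableT_comp mex).
exact: (measurableT_comp mey).
Qed.

(** For fixed proposals, a common uniform accepts both exactly when it lies below the smaller ratio.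
    This attains the largest joint acceptance probability that the two marginals allow. *)
Let integral_acc : (\int[P]_w (acc w)%:E = \int[nu]_w (min1 (ex w) (ey w))%:E)%E.
Proof.
rewrite /P (fubini_tonelli2 (fun w => (acc w)%:E)); last 2 first.
- exact/measurable_EFinP.
- by move=> w; rewrite lee_fin both_accept_ge0.
apply: eq_integral => w _; rewrite /fubini_G/=.
have mA : measurable [set u : R | u <= Num.min (expR (ex w)) (expR (ey w))].
  by rewrite -set_itvNyc; exact: measurable_itv.
rewrite (eq_integral (fun u => (\1_[set u : R | u <= Num.min (expR (ex w)) (expR (ey w))] u)%:E)).
  rewrite integral_indic// setIT; apply: unif_le.
  by rewrite le_min !expR_ge0.
move=> u _; rewrite indicE /acc /both_accept/=; congr (_%:E).
rewrite -natrM mulnb; congr (_%:R); rewrite (_ : (_ \in _) = (u <= Num.min (expR (ex w)) (expR (ey w)))) ?le_min//.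
by rewrite -le_min; apply/idP/idP => [/set_mem//|ub]; exact: mem_set.
Qed.

Let F (w : R * W) := cross_term h (vec X) (vec Y) w.1 (zx w.2) w.1 (zy w.2).
Let mF : measurable_fun setT F.
Proof.
apply: measurable_cross_term => // i.
  exact: (measurableT_comp (mzx i)).
exact: (measurableT_comp (mzy i)).
Qed.

Let E (w : R * W) := h ^+ 2 * `|dotv (zx w.2) (zy w.2) - d%:R|.
Let E0 w : 0 <= E w. Proof. by rewrite mulr_ge0// sqr_ge0. Qed.
Let mE : measurable_fun setT E.
Proof.
by apply: measurable_funM => //; exact: (measurableT_comp (mdev mzx mzy)).
Qed.

Let integral_E : exists2 e : R, (\int[P]_w (E w)%:E = e%:E)%E & e <= l ^+ 2 * C / sd.
Proof.
have ub : (\int[P]_w (E w)%:E <= (l ^+ 2 * C / sd)%:E)%E.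
  rewrite (integral_law (law_snd unif nu)
    (g := fun w => (h ^+ 2 * `|dotv (zx w) (zy w) - d%:R|)%:E)); last 2 first.
  - by apply/measurable_EFinP; apply: measurable_funM => //; exact: mdev.
  - by move=> w; rewrite lee_fin mulr_ge0// sqr_ge0.
  rewrite ge0_integral_EFinZ ?sqr_ge0//; last exact: mdev.
  rewrite mulrAC -h2sd -mulrA (mulrC sd) (EFinM (h ^+ 2)).
  by apply: lee_wpmul2l; rewrite ?lee_fin ?sqr_ge0.
have [|e e0 eE] := @ge0_integral_fineK R _ _ P _ E0.
  by rewrite (le_lt_trans ub) ?ltry.
by exists e => //; rewrite -lee_fin -eE.
Qed.

(** Uses [h^2 d = l^2] and [0 <= acc <= 1]. *)
Let FE w : `|F w - l ^+ 2 * acc w| <= E w.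
Proof.
rewrite /F cross_termE -/(ex w.2) -/(ey w.2) -/(acc w) -h2d /E.
rewrite -mulrBl -mulrBr normrM [X in X * _]normrM [X in X * _ * _]ger0_norm ?sqr_ge0//.
rewrite (ger0_norm (both_accept_ge0 _ _ _ _)).
by rewrite ler_piMr ?both_accept_le1// mulr_ge0// sqr_ge0.
Qed.

Let l20 : 0 <= l ^+ 2. Proof. exact: sqr_ge0. Qed.

Lemma shared_uniform_integrable : P.-integrable setT (EFin \o F).
Proof.
have [m mE' _] := integral_min1; have [e eE _] := integral_E.
have lacc w : 0 <= l ^+ 2 * acc w by rewrite mulr_ge0// both_accept_ge0.
apply/integrableP; split; first exact/measurable_EFinP.
apply: (@le_lt_trans _ _ (\int[P]_w (l ^+ 2 * acc w + E w)%:E)%E).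
  apply: (@ge0_le_integral_EFin R _ _ P (fun w => `|F w|)) => //.
  - exact: measurableT_comp.
  - by apply: measurable_funD => //; exact: measurable_funM.
  - move=> w; have := FE w; rewrite !ler_norml => /andP[H1 H2].
    by have l2 := lacc w; apply/andP; split; lra.
rewrite ge0_integral_EFinD//; last exact: measurable_funM.
rewrite ge0_integral_EFinZ//; last by move=> w; exact: both_accept_ge0.
by rewrite integral_acc mE' eE -EFinM -EFinD ltry.
Qed.

Lemma shared_uniform_bounds :
  ((l ^+ 2 * M - err)%:E <= \int[P]_w (F w)%:E <= (l ^+ 2 * M + err)%:E)%E.
Proof.
have [m mE' /andP[m1 m2]] := integral_min1; have [e eE e1] := integral_E.
have lacc w : 0 <= l ^+ 2 * acc w by rewrite mulr_ge0// both_accept_ge0.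
have Fint := shared_uniform_integrable.
have [f fE] : exists f, (\int[P]_w (F w)%:E = f%:E)%E.
  exists (fine (\int[P]_w (F w)%:E)); rewrite fineK//.
  exact: (integrable_fin_num _ Fint).
have l2acc : (\int[P]_w (l ^+ 2 * acc w)%:E = (l ^+ 2 * m)%:E)%E.
  by rewrite ge0_integral_EFinZ// ?integral_acc ?mE'// => w; exact: both_accept_ge0.
have ub : f <= l ^+ 2 * m + e.
  rewrite -lee_fin -fE EFinD -l2acc -eE -ge0_integral_EFinD//; last exact: measurable_funM.
  apply: le_integral_ge0 => //.
  - by apply: measurable_funD => //; exact: measurable_funM.
  - by move=> w; exact: addr_ge0.
  - by move=> w; have := FE w; rewrite ler_norml => /andP[_]; lra.
(* [F] may be negative, so the comparison is made as [l^2 acc <= F + E], with a nonnegative left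
   side; splitting the integral on the right uses the integrability of [F]. *)
have lb : l ^+ 2 * m <= f + e.
  have FEint : (\int[P]_w (F w + E w)%:E = (f + e)%:E)%E.
    under eq_integral do rewrite EFinD.
    rewrite integralD//; first by rewrite fE eE -EFinD.
    apply/integrableP; split; first exact/measurable_EFinP.
    under eq_integral do rewrite gee0_abs ?lee_fin//.
    by rewrite eE ltry.
  rewrite -lee_fin -l2acc -FEint; apply: ge0_le_integral_EFin => //.
  - exact: measurable_funM.
  - exact: measurable_funD.
  - by move=> w; have := FE w; rewrite ler_norml => /andP[+ _]; lra.
rewrite fE !lee_fin /err.
have errE : (l ^+ 2 + l ^+ 4) * C / sd = l ^+ 2 * (l ^+ 2 * C / sd) + l ^+ 2 * C / sd.
  by field; rewrite gt_eqF.
rewrite errE; set k := _ / _ in m1 m2 e1 *.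
have := ler_wpM2l l20 m1; have := ler_wpM2l l20 m2.
rewrite mulrDr mulrBr => ? ?; apply/andP; split; lra.
Qed.

End shared_uniform.

(** * Upper bound for an arbitrary product coupling *)

Section product_coupling.
Variables (P : probability (Omega d) R) (hP : product_coupling P).
Variables (p q : 'I_d -> R).
Hypotheses (p1 : dotv p p = 1) (q1 : dotv q q = 1)
  (Xp : forall Z, h * dotv (vec X) Z = a * dotv p Z)
  (Yq : forall Z, h * dotv (vec Y) Z = b * dotv q Z).
Hypothesis dev_le : forall nu : probability (d.-tuple R) R, gaussian nu ->
  (\int[nu]_z `|dotv (vec z) (vec z) - d%:R|%:E <= (C * sd)%:E)%E.

Let gauss_boxT : gauss_box (fun _ : 'I_d => [set: R]) = 1%E.
Proof. by rewrite /gauss_box big1// => i _; exact: (@probability_setT _ _ _ (gauss R)). Qed.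

Let E1 (z : d.-tuple R) := h ^+ 2 / 2 * `|dotv (vec z) (vec z) - d%:R|.
Let E10 z : 0 <= E1 z.
Proof. by rewrite mulr_ge0// divr_ge0// sqr_ge0. Qed.
Let mE1 : measurable_fun setT E1.
Proof.
apply: measurable_funM => //; apply: measurableT_comp => //.
by apply: measurable_funB => //; apply: measurable_fun_dotv => i; exact: measurable_vec.
Qed.
Let integral_E1 (nu : probability (d.-tuple R) R) : gaussian nu ->
  (\int[nu]_z (E1 z)%:E <= (l ^+ 2 * C / sd / 2)%:E)%E.
Proof.
move=> nug; rewrite ge0_integral_EFinZ//; last 2 first.
- apply: measurableT_comp => //; apply: measurable_funB => //.
  by apply: measurable_fun_dotv => i; exact: measurable_vec.
- by rewrite divr_ge0// sqr_ge0.
have -> : l ^+ 2 * C / sd / 2 = h ^+ 2 / 2 * (C * sd).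
  by rewrite (mulrAC (l ^+ 2)) -h2sd; field.
rewrite (EFinM (h ^+ 2 / 2)); apply: lee_wpmul2l; last exact: dev_le.
by rewrite lee_fin divr_ge0// sqr_ge0.
Qed.

Let ex (z : d.-tuple R) := log_ratio h (vec X) (vec z).
Let ey (z : d.-tuple R) := log_ratio h (vec Y) (vec z).
Let mex : measurable_fun setT ex.
Proof. by apply: measurable_log_ratio => i; exact: measurable_vec. Qed.
Let mey : measurable_fun setT ey.
Proof. by apply: measurable_log_ratio => i; exact: measurable_vec. Qed.

Lemma product_coupling_upper :
  (coupling_expect h X Y P <= (l ^+ 2 * M + err)%:E)%E.
Proof.
have [hP1 hP2 hP3] := hP.
have [P1 [_ P1E]] := law_exists P (@measurable_fst _ _ (R * R)%type _).
have LP2 := law_exists P (@measurable_snd _ _ (R * R)%type (d.-tuple R * d.-tuple R)%type).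
have [P2 LP] := LP2; have [_ P2E] := LP.
(* Independence of the uniforms from the proposals recovers [P] as the product of its two marginals,
   so that Tonelli applies with the proposals held fixed. *)
have PE A : measurable A -> (P1 \x P2)%E A = P A.
  apply: product_measure_unique => A1 A2 mA1 mA2.
  transitivity (P (fst @^-1` A1) * P (snd @^-1` A2))%E; first exact: hP3.
  by congr (_ * _)%E; [exact: P1E|exact: P2E].
have m1 (A : set R) : measurable A -> measurable [set u : R * R | A u.1].
  by move=> mA; rewrite -[X in measurable X]setTI; exact: measurable_fst.
have m2 (A : set R) : measurable A -> measurable [set u : R * R | A u.2].
  by move=> mA; rewrite -[X in measurable X]setTI; exact: measurable_snd.
have U1 A : measurable A -> P1 [set u | A u.1] = unif A.
  move=> mA; have mA' := m1 _ mA.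
  transitivity (unif A * gauss_box (fun _ : 'I_d => [set: R]))%E; last first.
    by rewrite gauss_boxT mule1.
  apply: (eq_trans (esym (P1E _ mA'))); apply: eq_trans (hP1 A (fun=> setT) mA (fun=> measurableT)).
  by congr (P _); apply/seteqP; split => w //= [].
have U2 A : measurable A -> P1 [set u | A u.2] = unif A.
  move=> mA; have mA' := m2 _ mA.
  transitivity (unif A * gauss_box (fun _ : 'I_d => [set: R]))%E; last first.
    by rewrite gauss_boxT mule1.
  apply: (eq_trans (esym (P1E _ mA'))); apply: eq_trans (hP2 A (fun=> setT) mA (fun=> measurableT)).
  by congr (P _); apply/seteqP; split => w //= [].
have [nu1 L1] := law_exists P2 (@measurable_fst _ _ (d.-tuple R) (d.-tuple R)).
have [nu2 L2] := law_exists P2 (@measurable_snd _ _ (d.-tuple R) (d.-tuple R)).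
have unifT : unif01 [set: R] = 1%E :> \bar R by exact: (@probability_setT _ _ _ unif).
have g1 : gaussian nu1.
  move=> B mB; rewrite -L1.2; last exact: measurable_box.
  rewrite -P2E; last first.
    rewrite -[X in measurable X]setTI; apply: measurable_fst => //.
    exact: measurable_box.
  rewrite -[RHS]mul1e -unifT -hP1//; congr (P _).
  by apply/seteqP; split => w //= [].
have g2 : gaussian nu2.
  move=> B mB; rewrite -L2.2; last exact: measurable_box.
  rewrite -P2E; last first.
    rewrite -[X in measurable X]setTI; apply: measurable_snd => //.
    exact: measurable_box.
  rewrite -[RHS]mul1e -unifT -hP2//; congr (P _).
  by apply/seteqP; split => w //= [].
pose D (z : d.-tuple R * d.-tuple R) := E1 z.1 + E1 z.2.
have D0 z : 0 <= D z by exact: addr_ge0.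
have mE11 : measurable_fun [set: d.-tuple R * d.-tuple R] (fun z => E1 z.1).
  exact: measurableT_comp.
have mE12 : measurable_fun [set: d.-tuple R * d.-tuple R] (fun z => E1 z.2).
  exact: measurableT_comp.
have mD : measurable_fun setT D by exact: measurable_funD.
have intD : (\int[P2]_z (D z)%:E <= (l ^+ 2 * C / sd)%:E)%E.
  rewrite ge0_integral_EFinD//.
  rewrite (integral_law L1 (g := fun z => (E1 z)%:E)); last 2 first.
  - exact/measurable_EFinP.
  - by move=> z; rewrite lee_fin.
  rewrite (integral_law L2 (g := fun z => (E1 z)%:E)); last 2 first.
  - exact/measurable_EFinP.
  - by move=> z; rewrite lee_fin.
  rewrite [X in (_ <= X%:E)%E](splitr (l ^+ 2 * C / sd)) EFinD.
  by apply: leeD; exact: integral_E1.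
pose acc (w : Omega d) := both_accept w.1.1 w.1.2 (ex w.2.1) (ey w.2.2).
have macc : measurable_fun setT acc.
  apply: measurable_both_accept.
  - exact: measurableT_comp.
  - exact: measurableT_comp.
  - by apply: (measurableT_comp mex); exact: measurableT_comp.
  - by apply: (measurableT_comp mey); exact: measurableT_comp.
pose lim (z : d.-tuple R * d.-tuple R) := min1 (ex z.1) (ey z.2).
have mlim : measurable_fun setT lim.
  by apply: measurable_min1; [exact: (measurableT_comp mex)|exact: (measurableT_comp mey)].
have int_acc : (\int[P]_w (acc w)%:E <= \int[P2]_z (lim z)%:E)%E.
  rewrite (@eq_measure_integral _ _ _ _ (P1 \x P2)%E); last first.
    by move=> A mA _; apply/esym; exact: PE.
  rewrite (fubini_tonelli2 (fun w => (acc w)%:E)); last 2 first.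
  - exact/measurable_EFinP.
  - by move=> w; rewrite lee_fin both_accept_ge0.
  apply: ge0_le_integral => //.
  - by move=> z _; apply: integral_ge0 => u _; rewrite lee_fin both_accept_ge0.
  - apply: (measurable_fun_fubini_tonelli_G (fun w => (acc w)%:E)).
      exact/measurable_EFinP.
    by move=> w; rewrite lee_fin both_accept_ge0.
  - exact/measurable_EFinP.
  move=> z _; rewrite /fubini_G.
  have mle t : measurable [set u : R | u <= t].
    by rewrite -set_itvNyc; exact: measurable_itv.
  have mle1 t : measurable [set u : R * R | u.1 <= t].
    exact: m1 (mle t).
  have mle2 t : measurable [set u : R * R | u.2 <= t].
    exact: m2 (mle t).
  (* However the uniforms are coupled, joint acceptance is no likelier than acceptance of either
     chain alone. This bound and [b2] together give [min1]. *)
  have b1 : (\int[P1]_u (acc (u, z))%:E <= (Num.min 1 (expR (ex z.1)))%:E)%E.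
    rewrite -unif_le_expR -U1// -[X in (_ <= P1 X)%E]setIT -integral_indic//; last exact: m1 (mle _).
    apply: ge0_le_integral => //.
    - by move=> u _; rewrite lee_fin both_accept_ge0.
    - by apply/measurable_EFinP; apply: (measurableT_comp macc); exact: pair2_measurable.
    - by apply/measurable_EFinP; apply: measurable_indic; exact: mle1.
    - move=> u _; rewrite lee_fin /acc /both_accept/= indicE.
      rewrite (_ : (u \in _) = (u.1 <= expR (ex z.1))); last first.
        by apply/idP/idP => [/set_mem//|ub]; exact: mem_set.
      by rewrite ler_piMr ?ler0n ?lern1 ?leq_b1.
  have b2 : (\int[P1]_u (acc (u, z))%:E <= (Num.min 1 (expR (ey z.2)))%:E)%E.
    rewrite -unif_le_expR -U2// -[X in (_ <= P1 X)%E]setIT -integral_indic//; last exact: m2 (mle _).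
    apply: ge0_le_integral => //.
    - by move=> u _; rewrite lee_fin both_accept_ge0.
    - by apply/measurable_EFinP; apply: (measurableT_comp macc); exact: pair2_measurable.
    - by apply/measurable_EFinP; apply: measurable_indic; exact: mle2.
    - move=> u _; rewrite lee_fin /acc /both_accept/= indicE.
      rewrite (_ : (u \in _) = (u.2 <= expR (ey z.2))); last first.
        by apply/idP/idP => [/set_mem//|ub]; exact: mem_set.
      by rewrite ler_piMl ?ler0n ?lern1 ?leq_b1.
  rewrite /lim /min1; case: (leP (expR (ex z.1)) (expR (ey z.2))) => _.
    exact: b1.
  exact: b2.
have int_lim : (\int[P2]_z (lim z)%:E <= (M + l ^+ 2 * C / sd)%:E)%E.
  have a0 : 0 <= a by rewrite mulr_ge0 ?sqrtr_ge0// ltW.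
  have b0 : 0 <= b by rewrite mulr_ge0 ?sqrtr_ge0// ltW.
  have c0 : 0 <= c by rewrite divr_ge0// sqr_ge0.
  (* Each potential depends on one projection, so its integral is the same for every coupling of the
     proposals; by [eq_sum] the two integrals add up to [M]. *)
  have [Phi [Psi [[mPhi Phi0] [mPsi Psi0] le_sum eq_sum]]] := min1_dual c0 a0 b0.
  have Lp := law_comp L1 (gaussian_dotv g1 p1).
  have Lq := law_comp L2 (gaussian_dotv g2 q1).
  have mp : measurable_fun setT (fun z : d.-tuple R * d.-tuple R => Phi (dotv p (vec z.1))).
    exact: (measurableT_comp mPhi Lp.1).
  have mq : measurable_fun setT (fun z : d.-tuple R * d.-tuple R => Psi (dotv q (vec z.2))).
    exact: (measurableT_comp mPsi Lq.1).
  apply: (@le_trans _ _ (\int[P2]_z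
      ((Phi (dotv p (vec z.1)) + Psi (dotv q (vec z.2))) + D z)%:E)%E).
    apply: ge0_le_integral_EFin => // [z||z]; first exact: min1_ge0.
      by apply: measurable_funD => //; exact: measurable_funD.
    apply: le_trans (lerD (le_sum _ _) (lexx _)).
    rewrite /D /E1 -(log_ratio_dev (Xp (vec z.1))) -(log_ratio_dev (Yq (vec z.2))).
    exact: min1_lip.
  rewrite ge0_integral_EFinD//; last 2 first.
  - exact: measurable_funD.
  - by move=> z; exact: addr_ge0.
  rewrite EFinD; apply: leeD => //.
  rewrite ge0_integral_EFinD//.
  rewrite (integral_law Lp (g := fun s => (Phi s)%:E)); last 2 first.
  - exact/measurable_EFinP.
  - by move=> s; rewrite lee_fin.
  rewrite (integral_law Lq (g := fun s => (Psi s)%:E)); last 2 first.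
  - exact/measurable_EFinP.
  - by move=> s; rewrite lee_fin.
  rewrite -ge0_integral_EFinD// -ME le_eqVlt; apply/orP; left; apply/eqP.
  by apply: eq_integral => s _; rewrite eq_sum.
have [|L L0 LE] := @ge0_integral_fineK R _ _ P2 lim (fun z => min1_ge0 _ _).
  by rewrite (le_lt_trans int_lim) ?ltry.
have [|e e0 eE] := @ge0_integral_fineK R _ _ P2 D D0.
  by rewrite (le_lt_trans intD) ?ltry.
have [|r r0 rE] := @ge0_integral_fineK R _ _ P acc (fun z => both_accept_ge0 _ _ _ _).
  by rewrite (le_lt_trans int_acc) ?LE ?ltry.
move: int_acc int_lim intD; rewrite LE eE rE !lee_fin => rL LM ek.
apply: (@le_trans _ _ (\int[P]_w (l ^+ 2 * acc w + D w.2)%:E)%E).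
  have mDw : measurable_fun [set: Omega d] (fun w => D w.2) by exact: measurableT_comp.
  apply: le_integral_ge0.
  - apply: measurable_cross_term.
    + exact: measurableT_comp.
    + exact: measurableT_comp.
    + by move=> i; apply: (measurableT_comp (measurable_vec i)); exact: measurableT_comp.
    + by move=> i; apply: (measurableT_comp (measurable_vec i)); exact: measurableT_comp.
  - by apply: measurable_funD => //; exact: measurable_funM.
  - by move=> w; rewrite addr_ge0// mulr_ge0 ?sqr_ge0// both_accept_ge0.
  - move=> w; rewrite cross_termE -/(ex w.2.1) -/(ey w.2.2) -/(acc w) -h2d /D /E1.
    set Zx := vec w.2.1; set Zy := vec w.2.2.
    have A0 : 0 <= acc w by exact: both_accept_ge0.
    have A1 : acc w <= 1 by exact: both_accept_le1.
    have ZZ : dotv Zx Zy <= (dotv Zx Zx + dotv Zy Zy) / 2.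
      have := dotv_ge0 (fun k => Zx k - Zy k).
      rewrite dotvBl ![dotv _ (fun k => _ - _)]dotvC !dotvBl (dotvC Zy Zx); lra.
    have abs_acc t : t * acc w <= `|t|.
      rewrite (le_trans (ler_norm _))// normrM (ger0_norm A0).
      by rewrite ler_piMr.
    have h20 : 0 <= h ^+ 2 by exact: sqr_ge0.
    (* The indicator is kept on the main term [d] and dropped from the deviations, where
       [0 <= acc w <= 1] suffices. *)
    have Q : dotv Zx Zy * acc w <= d%:R * acc w +
        (`|dotv Zx Zx - d%:R| + `|dotv Zy Zy - d%:R|) / 2.
      have := abs_acc (dotv Zx Zx - d%:R); have := abs_acc (dotv Zy Zy - d%:R).
      have := ler_wpM2r A0 ZZ; lra.
    by have := ler_wpM2l h20 Q; lra.
rewrite ge0_integral_EFinD//; last 3 first.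
- exact: measurable_funM.
- by move=> w; rewrite mulr_ge0 ?sqr_ge0// both_accept_ge0.
- exact: measurableT_comp.
rewrite ge0_integral_EFinZ ?sqr_ge0//; last by move=> w; exact: both_accept_ge0.
rewrite (integral_law LP (g := fun z => (D z)%:E)); last 2 first.
- exact/measurable_EFinP.
- by move=> z; rewrite lee_fin.
rewrite rE eE -EFinM -EFinD lee_fin /err.
have errE : (l ^+ 2 + l ^+ 4) * C / sd = l ^+ 2 * (l ^+ 2 * C / sd) + l ^+ 2 * C / sd.
  by field; rewrite gt_eqF.
rewrite errE addrA; apply: lerD => //.
by rewrite -mulrDr ler_wpM2l ?sqr_ge0// (le_trans rL).
Qed.

End product_coupling.
End core.

(** * Couplings *)

Lemma measurable_preimage d1 d2 (T1 : measurableType d1) (T2 : measurableType d2)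
    (f : T1 -> T2) (A : set T2) :
  measurable_fun setT f -> measurable A -> measurable (f @^-1` A).
Proof. by move=> mf mA; rewrite -[X in measurable X]setTI; exact: mf. Qed.

Section couplings.
Context {R : realType} (d : nat) (l x y C : R) (X Y : d.-tuple R).
Hypothesis d0 : (0 < d)%N.
Hypotheses (l0 : 0 < l) (x0 : 0 <= x) (y0 : 0 <= y).
Let h := l / Num.sqrt d%:R.
Let a := l * Num.sqrt x.
Let b := l * Num.sqrt y.
Let c := l ^+ 2 / 2.
Variable M : R.
Hypothesis ME :
  (\int[gauss R]_s (min1 (- (a * s) - c) (- (b * s) - c))%:E = M%:E)%E.
Let sd : R := Num.sqrt d%:R.
Hypothesis dev_le : forall nu : probability (d.-tuple R) R, gaussian nu ->
  (\int[nu]_z `|dotv (vec z) (vec z) - d%:R|%:E <= (C * sd)%:E)%E.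
Hypotheses (Xx : dotv (vec X) (vec X) / d%:R = x)
  (Yy : dotv (vec Y) (vec Y) / d%:R = y).
(** The scalar product of two GCRN noises costs an extra [4 * (1 + (1 + 1)) = 12] in mean, and the
    Householder coupling an extra 2. Since [1 <= sd], both are absorbed into [12 * sd]. *)
Let C' := C + 12.
Let err := (l ^+ 2 + l ^+ 4) * C' / sd.

Let sd1 : 1 <= sd.
Proof. by rewrite -[leLHS]sqrtr1 ler_wsqrtr// ler1n. Qed.

(** For [V = 0] both sides of the identity vanish, and a basis vector, available as [0 < d], can be
    chosen. *)
Lemma unit_direction (V : 'I_d -> R) : exists p : 'I_d -> R, dotv p p = 1 /\
  forall Z, dotv V Z = Num.sqrt (dotv V V) * dotv p Z.
Proof.
have [V0|V0] := eqVneq (dotv V V) 0.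
  have [i _] : exists i : 'I_d, True by exists (Ordinal d0).
  exists (fun k => (k == i)%:R); split.
    rewrite /dotv (bigD1 i)//= eqxx mul1r big1 ?addr0// => k /negbTE ->.
    by rewrite mul0r.
  move=> Z; rewrite V0 sqrtr0 mul0r (dotv_eq0 V0).
  by rewrite /dotv big1// => k _; rewrite mul0r.
have r0 : Num.sqrt (dotv V V) != 0.
  by rewrite sqrtr_eq0 -ltNge lt_neqAle eq_sym V0 dotv_ge0.
exists (fun k => (Num.sqrt (dotv V V))^-1 * V k); split; last first.
  by move=> Z; rewrite dotvZl mulrA divff// mul1r.
rewrite dotvZl dotvC dotvZl mulrA -[X in _ * X]sqr_sqrtr ?dotv_ge0//.
by rewrite -expr2 -exprMn mulVf// expr1n.
Qed.

Let scale_norm (V : 'I_d -> R) t : 0 <= t -> dotv V V / d%:R = t ->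
  h * Num.sqrt (dotv V V) = l * Num.sqrt t.
Proof.
move=> t0 Vt; have -> : dotv V V = t * d%:R by rewrite -Vt mulfVK// pnatr_eq0 -lt0n.
rewrite sqrtrM// /h -/sd mulrACA mulVf ?mulr1// gt_eqF//.
exact: lt_le_trans ltr01 sd1.
Qed.

Let dev_le' (nu : probability (d.-tuple R) R) : gaussian nu ->
  (\int[nu]_z `|dotv (vec z) (vec z) - d%:R|%:E <= (C' * sd)%:E)%E.
Proof.
move=> nug; apply: le_trans (dev_le nug) _; rewrite lee_fin ler_wpM2r ?lerDl//.
exact: sqrtr_ge0.
Qed.

Let mdev : measurable_fun [set: d.-tuple R]
  (fun z => `|dotv (vec z) (vec z) - d%:R|).
Proof.
apply: measurableT_comp => //; apply: measurable_funB => //.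
by apply: measurable_fun_dotv => i; exact: measurable_vec.
Qed.

Lemma integral_dotv_sqr (nu : probability (d.-tuple R) R) p : gaussian nu ->
  dotv p p = 1 -> (\int[nu]_z (dotv p (vec z) ^+ 2)%:E = 1)%E.
Proof.
move=> nug p1.
rewrite (integral_law (gaussian_dotv nug p1) (g := fun s : R => (s ^+ 2)%:E)).
- exact: integral_sqr.
- exact/measurable_EFinP/measurable_funX.
- by move=> s; rewrite lee_fin sqr_ge0.
Qed.

Lemma coupling_expect_le (P : probability (Omega d) R) : product_coupling P ->
  (coupling_expect h X Y P <= (l ^+ 2 * M + err)%:E)%E.
Proof.
move=> hP.
have [p [p1 Xp]] := unit_direction (vec X); have [q [q1 Yq]] := unit_direction (vec Y).
apply: (@product_coupling_upper R d l x y C' X Y d0 l0 M ME P hP p q) => //.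
- by move=> Z; rewrite Xp mulrA (scale_norm x0 Xx).
- by move=> Z; rewrite Yq mulrA (scale_norm y0 Yy).
Qed.

Lemma near_optimal_coupling : exists2 P : probability (Omega d) R,
  product_coupling P & ((l ^+ 2 * M - err)%:E <= coupling_expect h X Y P)%E.
Proof.
have [p [p1 Xp]] := unit_direction (vec X); have [q [q1 Yq]] := unit_direction (vec Y).
have [nu nug] := gaussian_exists R d.
have [T [w [LT w1 Tq TT Tz]]] := gaussian_transport nug p1 q1.
have [mT TE] := LT.
pose f (u : R * d.-tuple R) : Omega d := ((u.1, u.1), (u.2, T u.2)).
have mf : measurable_fun setT f.
  apply: measurable_fun_pair; first exact: measurable_fun_pair.
  by apply: measurable_fun_pair => //; exact: measurableT_comp.
pose mu := (unif \x nu : probability (R * d.-tuple R)%type R)%E.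
have [P LP] := law_exists mu mf; have [_ PE] := LP.
have muX A B : measurable A -> measurable B -> mu (A `*` B) = (unif A * nu B)%E.
  exact: product_measure1E.
have uT : unif [set: R] = 1%E by exact: (@probability_setT _ _ _ unif).
have nT : nu [set: d.-tuple R] = 1%E by exact: probability_setT.
(* The coupling is the image of [unif \x nu] under the diagonal in [u] and the graph of [T] in [z].
   The marginals and the independence clause are all read off this formula, the second Gaussian
   marginal by invariance under [T]. *)
have PX (A : set (R * R)) (B : set (d.-tuple R * d.-tuple R)) :
    measurable A -> measurable B ->
    P [set w | A w.1 /\ B w.2] =
    (unif [set u | A (u, u)] * nu [set z | B (z, T z)])%E.
  move=> mA mB; rewrite -muX; last 2 first.
  - by apply: (@measurable_preimage _ _ _ _ (fun u : R => (u, u))) => //; exact: measurable_fun_pair.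
  - by apply: (@measurable_preimage _ _ _ _ (fun z => (z, T z))) => //; exact: measurable_fun_pair.
  rewrite -PE//; exact: (@measurableX _ _ _ _ A B).
have mfst (A : set R) : measurable A -> measurable [set u : R * R | A u.1].
  by move=> mA; exact: (@measurable_preimage _ _ _ _ (fst : R * R -> R)).
have msnd (A : set R) : measurable A -> measurable [set u : R * R | A u.2].
  by move=> mA; exact: (@measurable_preimage _ _ _ _ (snd : R * R -> R)).
have mbox B : (forall i, measurable (B i)) -> measurable (box B : set (d.-tuple R)).
  exact: measurable_box.
exists P.
  split.
  - move=> A B mA mB.
    rewrite (PX [set u | A u.1] [set z | box B z.1])//; last 2 first.
    + exact: mfst.
    + by apply: (@measurable_preimage _ _ _ _ (fst : d.-tuple R * d.-tuple R -> _)) => //; exact: mbox.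
    by congr (_ * _)%E; exact: nug.
  - move=> A B mA mB.
    rewrite (PX [set u | A u.2] [set z | box B z.2])//; last 2 first.
    + exact: msnd.
    + by apply: (@measurable_preimage _ _ _ _ (snd : d.-tuple R * d.-tuple R -> _)) => //; exact: mbox.
    congr (_ * _)%E; rewrite -(nug B mB); exact: (TE _ (mbox _ mB)).
  - move=> A B mA mB; rewrite PX//.
    transitivity (P [set w | A w.1 /\ setT w.2] * P [set w | setT w.1 /\ B w.2])%E.
      rewrite !PX// uT mul1e; congr (_ * _)%E.
      by rewrite -[LHS]mule1 -nT.
    by congr (P _ * P _)%E; apply/seteqP; split => w' //= [].
rewrite /coupling_expect.
have mvec i : measurable_fun [set: d.-tuple R] (fun z => vec z i) by exact: measurable_vec.
have mvecT i : measurable_fun [set: d.-tuple R] (fun z => vec (T z) i).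
  exact: (measurableT_comp (measurable_vec i)).
pose g z := dotv p (vec z).
have Lg : law nu g (gauss R) by exact: gaussian_dotv.
have Xg z : h * dotv (vec X) (vec z) = a * g z by rewrite Xp mulrA (scale_norm x0 Xx).
have Yg z : h * dotv (vec Y) (vec (T z)) = b * g z.
  by rewrite Yq mulrA (scale_norm y0 Yy) Tq.
have devT : (\int[nu]_z `|dotv (vec (T z)) (vec (T z)) - d%:R|%:E <= (C' * sd)%:E)%E.
  by under eq_integral do rewrite TT; exact: dev_le'.
have devxT : (\int[nu]_z `|dotv (vec z) (vec (T z)) - d%:R|%:E <= (C' * sd)%:E)%E.
  have mw2 : measurable_fun [set: d.-tuple R] (fun z => dotv w (vec z) ^+ 2).
    by apply: measurable_funX; apply: measurable_fun_dotv.
  apply: (@le_trans _ _ (\int[nu]_z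
      (`|dotv (vec z) (vec z) - d%:R| + 2 * dotv w (vec z) ^+ 2)%:E)%E).
    apply: ge0_le_integral_EFin => //.
    - apply: measurableT_comp => //; apply: measurable_funB => //.
      exact: measurable_fun_dotv.
    - by apply: measurable_funD => //; exact: measurable_funM.
    - move=> z; have := Tz z.
      have := ler_normD (dotv (vec z) (vec (T z)) - dotv (vec z) (vec z))
        (dotv (vec z) (vec z) - d%:R).
      by rewrite subrKA; lra.
  rewrite ge0_integral_EFinD//; last 2 first.
  - exact: measurable_funM.
  - by move=> z; rewrite mulr_ge0// sqr_ge0.
  rewrite ge0_integral_EFinZ//; last by move=> z; exact: sqr_ge0.
  rewrite integral_dotv_sqr// mule1 /C' mulrDl (EFinD (C * sd)); apply: leeD; first exact: dev_le.
  by rewrite lee_fin; have := sd1; lra.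
have mG : measurable_fun setT (fun w : Omega d =>
    (cross_term h (vec X) (vec Y) w.1.1 (vec w.2.1) w.1.2 (vec w.2.2))%:E).
  apply/measurable_EFinP; apply: measurable_cross_term.
  + exact: measurableT_comp.
  + exact: measurableT_comp.
  + by move=> i; apply: (measurableT_comp (measurable_vec i)); exact: measurableT_comp.
  + by move=> i; apply: (measurableT_comp (measurable_vec i)); exact: measurableT_comp.
rewrite -(integral_law_integrable LP mG).
  by have /andP[] := @shared_uniform_bounds R d l x y C' X Y d0 M ME _ _ nu
    (fun z => vec z) (fun z => vec (T z)) g mvec mvecT Lg Xg Yg (dev_le' nug) devT devxT.
exact: (@shared_uniform_integrable R d l x y C' X Y d0 M ME _ _ nu
    (fun z => vec z) (fun z => vec (T z)) g mvec mvecT Lg Xg Yg (dev_le' nug) devT devxT).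
Qed.


(** * The GCRN coupling *)

Lemma dotv_gcrn_noise (p n Z : 'I_d -> R) z :
  dotv p (gcrn_noise n Z z) = dotv p Z + (z - dotv n Z) * dotv p n.
Proof.
rewrite /gcrn_noise; move: (dotv n Z) => t.
rewrite /dotv mulr_sumr -big_split; apply: eq_bigr => k _ /=; ring.
Qed.

(** At [V = 0] the convention [0^-1 = 0] gives [n = 0]. The last clause, [|V| |n|^2 = |V|], holds in
    both cases and replaces [|n| = 1] in the computations. *)
Lemma gcrn_dirP (V : 'I_d -> R) : let n := gcrn_dir V in
  (dotv n n = 1 \/ n = fun=> 0) /\
  (forall Z, dotv V Z = - Num.sqrt (dotv V V) * dotv n Z) /\
  Num.sqrt (dotv V V) * dotv n n = Num.sqrt (dotv V V).
Proof.
move=> n; have [V0|V0] := eqVneq (dotv V V) 0.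
  split; first by right; apply/funext => k; rewrite /n /gcrn_dir V0 sqrtr0 invr0 mulr0.
  split; last by rewrite V0 sqrtr0 mul0r.
  move=> Z; rewrite V0 sqrtr0 oppr0 mul0r (dotv_eq0 V0).
  by rewrite /dotv big1// => k _; rewrite mul0r.
set r := Num.sqrt _.
have r0 : r != 0 by rewrite sqrtr_eq0 -ltNge lt_neqAle eq_sym V0 dotv_ge0.
have r2 : r ^+ 2 = dotv V V by rewrite sqr_sqrtr// dotv_ge0.
have nE Z : dotv n Z = - r^-1 * dotv V Z.
  rewrite -dotvZl; apply: eq_bigr => k _; rewrite /n /gcrn_dir -/r; congr (_ * _).
  by rewrite mulNr mulrC mulNr.
have nn : dotv n n = 1 by rewrite nE dotvC nE -r2; field.
split; [by left|split => [Z|]]; last by rewrite nn mulr1.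
by rewrite nE mulrA mulrNN divff// mul1r.
Qed.

Lemma dotv_le1 (n m : 'I_d -> R) : dotv n n <= 1 -> dotv m m <= 1 ->
  `|dotv n m| <= 1.
Proof.
move=> n1 m1; rewrite ler_norml; apply/andP; split.
  have := dotv_ge0 (fun k => n k - -1 * m k).
  rewrite dotvBl dotvZl ![dotv _ (fun k => _ - _)]dotvC !dotvBl !dotvZl (dotvC m n); lra.
have := dotv_ge0 (fun k => n k - m k).
rewrite dotvBl ![dotv _ (fun k => _ - _)]dotvC !dotvBl (dotvC m n); lra.
Qed.

(** Each noise is [Z] plus a multiple [z - n.Z] or [z - m.Z] of its direction, so the scalar product
    exceeds [|Z|^2] by a quadratic form in [z], [n.Z] and [m.Z] with bounded coefficients; 4 is a
    convenient bound. *)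
Lemma gcrn_noise_dotv_dev (n m Z : 'I_d -> R) z :
  dotv n n <= 1 -> dotv m m <= 1 ->
  `|dotv (gcrn_noise n Z z) (gcrn_noise m Z z) - dotv Z Z| <=
  4 * (z ^+ 2 + (dotv n Z ^+ 2 + dotv m Z ^+ 2)).
Proof.
move=> n1 m1; have t1 := dotv_le1 n1 m1.
rewrite dotv_gcrn_noise !(dotvC (gcrn_noise n Z z)) !dotv_gcrn_noise.
rewrite (dotvC m n) (dotvC Z n); move: (dotv n m) t1 => t t1.
move: (dotv n Z) (dotv m Z) (dotv Z Z) => u v s.
have st : `|(z - u) * (z - v) * t| <= ((z - u) ^+ 2 + (z - v) ^+ 2) / 2.
  rewrite normrM; apply: (@le_trans _ _ `|(z - u) * (z - v)|).
    by rewrite ler_piMr.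
  rewrite ler_norml; apply/andP; split.
    have := sqr_ge0 ((z - u) + (z - v)); lra.
  have := sqr_ge0 ((z - u) - (z - v)); lra.
move: st; rewrite !ler_norml => /andP[st1 st2].
have := sqr_ge0 (z + u); have := sqr_ge0 (z + v); have := sqr_ge0 (z - u).
have := sqr_ge0 (z - v); have := sqr_ge0 z; have := sqr_ge0 u; have := sqr_ge0 v.
by move=> *; apply/andP; split; lra.
Qed.

Section gcrn.
Variables (Q : probability (GOmega d) R) (hQ : gcrn_law Q).

Let VR := (d.-tuple R * R)%type.
Let GO := (R * VR)%type.

(** [gcrn_law] prescribes only products of a set, a box and a set. Each factor in turn is extended
    to all measurable sets, with the others fixed, by uniqueness of finite measures. *)
Lemma gcrn_indep (nu : probability VR R) : law Q snd nu ->
  forall A, measurable A -> (unif \x nu)%E A = Q A.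
Proof.
move=> [_ nuE]; apply: product_measure_unique => A M' mA mM'.
have uE : unif A = (fine (unif A))%:E by rewrite fineK// fin_num_measure.
have u0 : 0 <= fine (unif A) by rewrite fine_ge0.
have uT : unif01 [set: R] = 1%E :> \bar R by exact: (@probability_setT _ _ _ unif).
pose D := [set w : GO | A w.1].
have mD : measurable D by exact: (@measurable_preimage _ _ _ _ (fst : GO -> R)).
have msnd : measurable_fun setT (snd : GO -> VR) by [].
have m21 : measurable_fun setT (fun w : GO => w.2.1).
  by apply: (@measurableT_comp _ _ _ _ _ _ (fst : VR -> d.-tuple R) _ (snd : GO -> VR)).
have m22 : measurable_fun setT (fun w : GO => w.2.2).
  by apply: (@measurableT_comp _ _ _ _ _ _ (snd : VR -> R) _ (snd : GO -> VR)).
have fstM : measurable_fun setT (fst : VR -> d.-tuple R) by [].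
(* With [A] fixed, this is a measure on the pairs [(Z, Z_1)], to be compared with [nu] scaled by
   [unif A]. *)
pose m1 := pushforward (mrestr Q mD) (snd : GO -> VR).
transitivity (m1 M').
  by congr (Q _); apply/seteqP; split => w [].
transitivity (mscale (NngNum u0) nu M'); last first.
  by congr (_ * _)%E; exact/esym/uE.
apply: rect_unique => //.
  rewrite /m1 /pushforward /mrestr.
  apply: le_lt_trans (probability_le1 Q _) (ltry 1).
  by apply: measurableI => //; exact: measurable_preimage.
move=> B C1 mB mC1.
pose E := [set w : GO | A w.1 /\ C1 w.2.2].
have mE : measurable E.
  rewrite (_ : E = D `&` (fun w : GO => w.2.2) @^-1` C1)//.
  by apply: measurableI => //; exact: measurable_preimage.
pose E' := [set w : VR | C1 w.2].
have mE' : measurable E' by exact: (@measurable_preimage _ _ _ _ (snd : VR -> R)).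
(* With [C1] fixed as well, what remains is a measure on tuples, determined by its values on
   boxes. *)
transitivity (pushforward (mrestr Q mE) (fun w : GO => w.2.1) B).
  by congr (Q _); apply/seteqP; split => w; [move=> [[]]|move=> [? []]].
transitivity (pushforward (mscale (NngNum u0) (mrestr nu mE')) (fst : VR -> d.-tuple R) B).
  apply: box_unique => //.
    rewrite /pushforward /mrestr.
    apply: le_lt_trans (probability_le1 Q _) (ltry 1).
    by apply: measurableI => //; exact: measurable_preimage.
  move=> b0 mb0; have mbox0 : measurable (box b0) by exact: measurable_box.
  transitivity (unif01 A * gauss_box b0 * normal_prob 0 1 C1)%E.
    rewrite -hQ//; congr (Q _).
    by apply/seteqP; split => w; [move=> [? []]|move=> []].
  rewrite -[RHS]/((fine (unif A))%:E * nu ((fst : VR -> d.-tuple R) @^-1` box b0 `&` E'))%E.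
  rewrite -uE -muleA; congr (_ * _)%E; rewrite -nuE; last first.
    by apply: measurableI => //; exact: measurable_preimage.
  rewrite -[LHS]mul1e -uT muleA -hQ//; congr (Q _).
  by apply/seteqP; split => w; [move=> []|move=> []].
by rewrite /mscale; congr (_ * _)%E.
Qed.

Lemma gcrn_marginals (nu : probability VR R) : law Q snd nu ->
  law nu snd (gauss R) /\
  exists2 nu1 : probability (d.-tuple R) R, gaussian nu1 & law nu fst nu1.
Proof.
move=> [_ nuE].
have uT : unif01 [set: R] = 1%E :> \bar R by exact: (@probability_setT _ _ _ unif).
have nT : normal_prob 0 1 [set: R] = 1%E :> \bar R by exact: (@probability_setT _ _ _ (gauss R)).
have bT : gauss_box (fun _ : 'I_d => [set: R]) = 1%E.
  by rewrite /gauss_box big1// => i _; exact: (@probability_setT _ _ _ (gauss R)).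
split.
  split=> // A mA; rewrite -nuE; last by exact: (@measurable_preimage _ _ _ _ (snd : VR -> R)).
  rewrite -[RHS]mul1e -[in RHS]bT -[in RHS](mul1e (gauss_box _)) -[in RHS]uT.
  rewrite -[RHS](@hQ setT (fun=> setT) A)//; congr (Q _).
  by apply/seteqP; split => w //= [].
have [nu1 L1] := law_exists nu (@measurable_fst _ _ (d.-tuple R) R).
exists nu1 => // B mB; rewrite -L1.2; last exact: measurable_box.
rewrite -nuE; last first.
  by apply: (@measurable_preimage _ _ _ _ (fst : VR -> _)) => //; exact: measurable_box.
rewrite -[RHS]mule1 -nT -[gauss_box B]mul1e -uT -hQ//; congr (Q _).
by apply/seteqP; split => w //= [].
Qed.

Lemma gcrn_expect_bounds :
  ((l ^+ 2 * M - err)%:E <= gcrn_expect h X Y Q <= (l ^+ 2 * M + err)%:E)%E.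
Proof.
have [nu Lnu] := law_exists Q (@measurable_snd _ _ R VR).
have [L2 [nu1 g1 L1]] := gcrn_marginals Lnu.
rewrite /gcrn_expect (@eq_measure_integral _ _ _ _ (unif \x nu)%E); last first.
  by move=> A mA _; apply/esym; exact: gcrn_indep.
have [dX [Xn Xr]] := gcrn_dirP (vec X); have [dY [Yn Yr]] := gcrn_dirP (vec Y).
set nx := gcrn_dir (vec X) in dX Xn Xr *; set ny := gcrn_dir (vec Y) in dY Yn Yr *.
have le1 (n : 'I_d -> R) : dotv n n = 1 \/ n = (fun=> 0) -> dotv n n <= 1.
  by move=> [->//|->]; rewrite /dotv big1 ?ler01// => k _; rewrite mul0r.
have mvec1 i : measurable_fun [set: VR] (fun w => vec w.1 i).
  by apply: (measurableT_comp (measurable_vec i)).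
have mdot (n : 'I_d -> R) : measurable_fun [set: VR] (fun w => dotv n (vec w.1)).
  by apply: measurable_fun_dotv => // i; exact: measurable_vec.
have mnoise (n : 'I_d -> R) i :
    measurable_fun [set: VR] (fun w => gcrn_noise n (vec w.1) w.2 i).
  apply: measurable_funD; last exact: measurable_funM.
  by apply: measurable_funB => //; exact: measurable_funM.
have int1 (n : 'I_d -> R) : dotv n n = 1 \/ n = (fun=> 0) ->
    (\int[nu]_w (dotv n (vec w.1) ^+ 2)%:E <= 1)%E.
  move=> [n1|->]; last first.
    rewrite integral0_eq ?lee01// => w _.
    by rewrite /dotv big1 ?expr0n//= => k _; rewrite mul0r.
  rewrite (integral_law L1 (g := fun z => (dotv n (vec z) ^+ 2)%:E)).
  - by rewrite integral_dotv_sqr.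
  - apply/measurable_EFinP; apply: measurable_funX; apply: measurable_fun_dotv => // i.
    exact: measurable_vec.
  - by move=> z; rewrite lee_fin sqr_ge0.
have int2 : (\int[nu]_w (w.2 ^+ 2)%:E = 1)%E.
  rewrite (integral_law L2 (g := fun s : R => (s ^+ 2)%:E)).
  - exact: integral_sqr.
  - exact/measurable_EFinP/measurable_funX.
  - by move=> s; rewrite lee_fin sqr_ge0.
have dev (n m : 'I_d -> R) :
    dotv n n = 1 \/ n = (fun=> 0) -> dotv m m = 1 \/ m = (fun=> 0) ->
    (\int[nu]_w `|dotv (gcrn_noise n (vec w.1) w.2) (gcrn_noise m (vec w.1) w.2) - d%:R|%:E
      <= (C' * sd)%:E)%E.
  move=> hn hm.
  have msq (k : 'I_d -> R) : measurable_fun [set: VR] (fun w => dotv k (vec w.1) ^+ 2).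
    exact: measurable_funX.
  have m2 : measurable_fun [set: VR] (fun w => w.2 ^+ 2) by exact: measurable_funX.
  have mdev1 : measurable_fun [set: VR] (fun w => `|dotv (vec w.1) (vec w.1) - d%:R|).
    by apply: (measurableT_comp mdev).
  have msum : measurable_fun [set: VR]
      (fun w => dotv n (vec w.1) ^+ 2 + dotv m (vec w.1) ^+ 2) by exact: measurable_funD.
  have msum' : measurable_fun [set: VR]
      (fun w => w.2 ^+ 2 + (dotv n (vec w.1) ^+ 2 + dotv m (vec w.1) ^+ 2)).
    exact: measurable_funD.
  have sq0 (k : 'I_d -> R) (w : VR) : 0 <= dotv k (vec w.1) ^+ 2 by exact: sqr_ge0.
  have ssq0 (w : VR) : 0 <= dotv n (vec w.1) ^+ 2 + dotv m (vec w.1) ^+ 2.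
    exact: addr_ge0.
  have ssq0' (w : VR) : 0 <= w.2 ^+ 2 + (dotv n (vec w.1) ^+ 2 + dotv m (vec w.1) ^+ 2).
    by rewrite addr_ge0// sqr_ge0.
  apply: (@le_trans _ _ (\int[nu]_w (`|dotv (vec w.1) (vec w.1) - d%:R| +
      4 * (w.2 ^+ 2 + (dotv n (vec w.1) ^+ 2 + dotv m (vec w.1) ^+ 2)))%:E)%E).
    apply: ge0_le_integral_EFin => //.
    - apply: measurableT_comp => //; apply: measurable_funB => //.
      by apply: measurable_fun_dotv => i; exact: mnoise.
    - by apply: measurable_funD => //; exact: measurable_funM.
    - move=> w; have := gcrn_noise_dotv_dev (vec w.1) w.2 (le1 _ hn) (le1 _ hm).
      set u := dotv _ _; set v := dotv _ _.
      have := ler_normD (u - v) (v - d%:R); rewrite subrKA; lra.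
  rewrite ge0_integral_EFinD//; last 2 first.
  - exact: measurable_funM.
  - by move=> w; rewrite mulr_ge0.
  rewrite ge0_integral_EFinZ// ge0_integral_EFinD//; last by move=> w; exact: sqr_ge0.
  rewrite ge0_integral_EFinD// int2 /C' mulrDl (EFinD (C * sd)); apply: leeD.
    rewrite (integral_law L1 (g := fun z => `|dotv (vec z) (vec z) - d%:R|%:E)).
    - exact: dev_le.
    - exact/measurable_EFinP.
    - by move=> z; rewrite lee_fin.
  apply: (@le_trans _ _ (4%:E * (1 + (1 + 1)))%E).
    by apply: lee_wpmul2l => //; apply: leeD2l; apply: leeD; exact: int1.
  by rewrite -!EFinD -EFinM lee_fin; have := sd1; lra.
(* The directions point against the states, so the common projection is [- Z_1], standard normal by
   symmetry. *)
have Lg := law_comp L2 (@law_gauss_opp R).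
have Xg (w : VR) : h * dotv (vec X) (gcrn_noise nx (vec w.1) w.2) = a * (-%R \o snd) w.
  rewrite Xn dotv_gcrn_noise /a -(scale_norm x0 Xx)/=; move: Xr.
  move: (Num.sqrt _) (dotv nx nx) (dotv nx (vec w.1)) => r n2 t rn.
  transitivity (h * (- r * t - (w.2 - t) * (r * n2))); first by ring.
  by rewrite rn; ring.
have Yg (w : VR) : h * dotv (vec Y) (gcrn_noise ny (vec w.1) w.2) = b * (-%R \o snd) w.
  rewrite Yn dotv_gcrn_noise /b -(scale_norm y0 Yy)/=; move: Yr.
  move: (Num.sqrt _) (dotv ny ny) (dotv ny (vec w.1)) => r n2 t rn.
  transitivity (h * (- r * t - (w.2 - t) * (r * n2))); first by ring.
  by rewrite rn; ring.
exact: (@shared_uniform_bounds R d l x y C' X Y d0 M ME _ _ nu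
  (fun w => gcrn_noise nx (vec w.1) w.2) (fun w => gcrn_noise ny (vec w.1) w.2)
  (-%R \o snd) (mnoise nx) (mnoise ny) Lg Xg Yg (dev _ _ dX dX) (dev _ _ dY dY)
  (dev _ _ dX dY)).
Qed.

End gcrn.

End couplings.

(** * Passage to the limit *)

Lemma cvg_div_sqrt (R : realType) (k : R) :
  (fun d : nat => k / Num.sqrt d%:R) @ \oo --> (0 : R).
Proof.
suff : (fun d : nat => (Num.sqrt d%:R)^-1) @ \oo --> (0 : R).
  by move=> /(cvgM (cvg_cst k)); rewrite mulr0; apply.
rewrite -cvg_shiftS.
rewrite (_ : (fun n => _) = Num.sqrt \o (@harmonic R)); last first.
  by apply/funext => n /=; rewrite sqrtrV.
have := @sqrt_continuous R 0; rewrite /continuous_at sqrtr0.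
by apply: cvg_comp; exact: cvg_harmonic.
Qed.

Lemma squeeze_div_sqrt (R : realType) (m k : R) (u : nat -> \bar R) :
  (\forall d \near \oo, ((m - k / Num.sqrt d%:R)%:E <= u d <= (m + k / Num.sqrt d%:R)%:E)%E) ->
  u @ \oo --> m%:E.
Proof.
move=> Hu; apply: (squeeze_cvge Hu).
  apply: cvg_EFin; first by near=> d.
  by have := cvgB (cvg_cst m) (cvg_div_sqrt k); rewrite subr0; apply.
apply: cvg_EFin; first by near=> d.
by have := cvgD (cvg_cst m) (cvg_div_sqrt k); rewrite addr0; apply.
Unshelve. all: by end_near. Qed.

Theorem theorem2 (R : realType) (l x y v : R) (X Y : forall d : nat, d.-tuple R) :
  0 < l -> S_set (x, y, v) ->
  (\forall d \near \oo,
     [/\ dotv (vec (X d)) (vec (X d)) / d%:R = x,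
         dotv (vec (Y d)) (vec (Y d)) / d%:R = y &
         dotv (vec (X d)) (vec (Y d)) / d%:R = v]) ->
  (fun d : nat => sup_I (l / Num.sqrt d%:R) (X d) (Y d)) @ \oo --> limit_value l x y
  /\
  (forall Q : forall d : nat, probability (GOmega d) R,
     (forall d, gcrn_law (Q d)) ->
     (fun d : nat => gcrn_expect (l / Num.sqrt d%:R) (X d) (Y d) (Q d)) @ \oo
       --> limit_value l x y).
Proof.
move=> l0 [/= x0 [y0 _]] XY.
have [C dev] := gaussian_normsq_dev (R := R).
have [M -> ME] := limit_valueE l x y.
(* The numerator of the fixed-dimension error, free of [d]. *)
pose k := (l ^+ 2 + l ^+ 4) * (C + 12).
split=> [|Q hQ]; apply: (@squeeze_div_sqrt _ _ k).
  near=> d.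
  have d0 : (0 < d)%N by near: d; exact: nbhs_infty_gt.
  have [Xx Yy _] : [/\ dotv (vec (X d)) (vec (X d)) / d%:R = x,
         dotv (vec (Y d)) (vec (Y d)) / d%:R = y &
         dotv (vec (X d)) (vec (Y d)) / d%:R = v] by near: d.
  have dev_d (nu : probability (d.-tuple R) R) (nug : gaussian nu) := dev d nu d0 nug.
  apply/andP; split.
    have [P hP le_P] := near_optimal_coupling d0 x0 y0 ME dev_d Xx Yy.
    by apply: le_trans le_P _; apply: ereal_sup_ubound; exists P.
  apply: ge_ereal_sup => _ [P [hP ->]].
  exact: (coupling_expect_le d0 l0 x0 y0 ME dev_d Xx Yy hP).
near=> d.
have d0 : (0 < d)%N by near: d; exact: nbhs_infty_gt.
have [Xx Yy _] : [/\ dotv (vec (X d)) (vec (X d)) / d%:R = x,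
       dotv (vec (Y d)) (vec (Y d)) / d%:R = y &
       dotv (vec (X d)) (vec (Y d)) / d%:R = v] by near: d.
have dev_d (nu : probability (d.-tuple R) R) (nug : gaussian nu) := dev d nu d0 nug.
exact: (gcrn_expect_bounds d0 x0 y0 ME dev_d Xx Yy (hQ d)).
Unshelve. all: by end_near. Qed.
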